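(* Consider the Jointly Optimal Power Control and Routing (JOPR) problem: minimize $D=\sum_{(i,j)\in\mathcal E} D_{ij}(C_{ij},F_{ij})$ over feasible routing variables $\{\phi_{ij}(w)\}$, power allocation variables $\{\eta_{ij}\}$ and power control variables $\{\gamma_i\}$, where $F_{ij}$ and $C_{ij}$ are determined by these variables as in the context. Assume the link cost functions satisfy the conditions in the context. (Necessity.) For a feasible set $\{\phi_{ij}(w)\}_{w\in\mathcal W,(i,j)\in\mathcal E}$, $\{\eta_{ij}\}_{(i,j)\in\mathcal E}$, $\{\gamma_i\}_{i\in\mathcal N}$ to be a solution of JOPR, the following conditions are necessary. (a) For all $w\in\mathcal W$ and $i\ne D(w)$ with $t_i(w)>0$ there exists a constant $\lambda_i(w)$ such that, for $j\in\mathcal O(i)$, $$\delta\phi_{ij}(w)=\lambda_i(w)\ \text{ if }\phi_{ij}(w)>0,\qquad \delta\phi_{ij}(w)\ge\lambda_i(w)\ \text{ if }\phi_{ij}(w)=0.$$ (b) For all $i\in\mathcal N$, all $\eta_{ij}>0$ ($j\in\mathcal O(i)$), and there exists a constant $\nu_i$ such that $$\delta\eta_{ij}=\nu_i\ \ \forall j\in\mathcal O(i),\qquad \frac{\delta\gamma_i}{P_i}=0\ \text{ if }\gamma_i<1,\qquad \frac{\delta\gamma_i}{P_i}\le 0\ \text{ if }\gamma_i=1 .$$ (Sufficiency.) If the link cost functions $D_{ij}(C_{ij},F_{ij})$ are also jointly convex in $(C_{ij},F_{ij})$, then these conditions are sufficient for optimality if the routing condition in (a) holds at every $i\neq D(w)$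 for all $w\in\mathcal W$, whether $t_i(w)>0$ or not.
   Context: Network and routing. $(\mathcal N,\mathcal E)$ is a finite, strongly connected directed graph; $\mathcal O(i)=\{j:(i,j)\in\mathcal E\}$, $\mathcal I(i)=\{j:(j,i)\in\mathcal E\}$. $\mathcal W$ is a finite set of sessions; session $w$ has origin $O(w)$, destination $D(w)$ and fixed input rate $r_w>0$. Routing variables are feasible if $\phi_{ij}(w)\ge 0$ for $j\in\mathcal O(i)$, $\sum_{j\in\mathcal O(i)}\phi_{ij}(w)=1$ for $i\ne D(w)$, and $\phi_{ij}(w)=0$ for all $j\in\mathcal O(i)$ if $i=D(w)$. Node rates and link flows are given by $t_i(w)=r_w$ if $i=O(w)$, $t_i(w)=\sum_{j\in\mathcal I(i)}t_j(w)\phi_{ji}(w)$ if $i\neq O(w)$, and $F_{ij}=\sum_{w\in\mathcal W}t_i(w)\phi_{ij}(w)$. Link costs. With $\mathcal X=\{(C,F):0\le F<C\}$, each $D_{ij}$ is nonnegative and twice continuously differentiable on $\mathcal X$, with $\partial D_{ij}/\partial C_{ij}<0$, $\partial D_{ij}/\partial F_{ij}>0$, $\partial^2D_{ij}/\partial C_{ij}^2\ge0$, $\partial^2D_{ij}/\partial F_{ij}^2\ge0$ on $\mathcal X$; $D_{ij}(C_{ij},F_{ij})\to\infty$ as $F_{ij}\to C_{ij}^-$, and $D_{ij}=\infty$ outside $\mathcal X$ (in particular when $C_{ij}=0$). Powers and capacities. Node $i$ has power limit $\bar P_i>1$ and receiver noise power $N_i$; $G_{mj}$ is the constant path gain from node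 $m$ to node $j$. Feasible power variables: $\eta_{ij}\ge0$, $\sum_{j\in\mathcal O(i)}\eta_{ij}=1$, $\gamma_i\le1$. Then $P_i=(\bar P_i)^{\gamma_i}$, $P_{ij}=P_i\eta_{ij}$. For $(i,j)\in\mathcal E$, $$IN_{ij}=G_{ij}\sum_{k\ne j}P_{ik}+\sum_{m\ne i}G_{mj}P_m+N_j,\qquad x_{ij}=SINR_{ij}=\frac{G_{ij}P_{ij}}{IN_{ij}},\qquad C_{ij}=C(x_{ij}),$$ where $C(\cdot)$ is strictly increasing, concave and twice continuously differentiable on $(0,\infty)$, with $C''(x)x+C'(x)\le0$. $C'_{ij}$ means $C'(x_{ij})$. Marginal costs (where the link costs are finite, so that the derivatives exist). $\partial D/\partial r_i(w)$ is defined recursively by $\partial D/\partial r_{D(w)}(w)=0$ and, for $i\neq D(w)$, $\partial D/\partial r_i(w)=\sum_{j\in\mathcal O(i)}\phi_{ij}(w)\,\delta\phi_{ij}(w)$, where $$\delta\phi_{ij}(w)=\frac{\partial D_{ij}}{\partial F_{ij}}+\frac{\partial D}{\partial r_j(w)}.$$ Furthermore $$\delta\eta_{ij}=\frac{\partial D_{ij}}{\partial C_{ij}}\frac{C'_{ij}G_{ij}}{IN_{ij}}(1+SINR_{ij}),$$ $$\delta\gamma_i=P_i\Big[-\sum_{(m,n)\in\mathcal E}\frac{\partial D_{mn}}{\partial C_{mn}}\frac{C'_{mn}G_{mn}G_{in}P_{mn}}{IN_{mn}^2}+\sum_{j\in\mathcal O(i)}\delta\eta_{ij}\,\eta_{i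j}\Big].$$
   Formalization: Feasible routing is additionally required to make the node-rate equations uniquely solvable and to send no traffic of a session back to its origin O(w); otherwise rates are undefined, or returned traffic vanishes under t_i(w)=r_w at the origin and condition (a) is not necessary. *)

(* Defs.v *)
(* MathComp + MathComp-Analysis, over an arbitrary realType R. *)
From HB Require Import structures.
From mathcomp Require Import all_boot all_order all_algebra.
From mathcomp Require Import all_classical all_reals all_analysis.

Set Implicit Arguments.
Unset Strict Implicit.
Unset Printing Implicit Defensive.

Import Order.TTheory GRing.Theory Num.Theory.
Import numFieldNormedType.Exports.

Local Open Scope classical_set_scope.
Local Open Scope ring_scope.

(* The domain X contains its boundary {F = 0}, where only one-sided
   differentiation in F makes sense: derivatives are therefore limits of
   difference quotients restricted to increments that stay in the domain.
   (The domain is open in the direction of C, where this is the ordinary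
   derivative.) *)
Definition quot_in {R : realType} (A : set R) (f : R -> R) (x : R) :=
  (fun h : R => h^-1 * (f (x + h) - f x)) @ within [set h | A (x + h)] 0^'.

Definition derivable_in {R : realType} (A : set R) (f : R -> R) (x : R) : Prop :=
  cvg (quot_in A f x).

Definition derive_in {R : realType} (A : set R) (f : R -> R) (x : R) : R :=
  lim (quot_in A f x).

Definition Xdom {R : realType} : set (R * R) := [set p | 0 <= p.2 < p.1].

Definition dC {R : realType} (f : R -> R -> R) (c x : R) : R :=
  derive_in [set c' | Xdom (c', x)] (fun c' => f c' x) c.

Definition dF {R : realType} (f : R -> R -> R) (c x : R) : R :=
  derive_in [set x' | Xdom (c, x')] (fun x' => f c x') x.

Definition C1_on_X {R : realType} (f : R -> R -> R) : Prop :=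
  [/\ forall c x, Xdom (c, x) ->
        derivable_in [set c' | Xdom (c', x)] (fun c' => f c' x) c /\
        derivable_in [set x' | Xdom (c, x')] (fun x' => f c x') x,
      {within Xdom, continuous (fun p : R * R => dC f p.1 p.2)}
    & {within Xdom, continuous (fun p : R * R => dF f p.1 p.2)}].

Definition C2_on_X {R : realType} (f : R -> R -> R) : Prop :=
  [/\ C1_on_X f, C1_on_X (dC f) & C1_on_X (dF f)].

(* Only the values of [Dcost i j] on X matter: see [link_cost]. *)
Record network (R : realType) := Network {
  node : finType;
  edge : rel node;
  session : finType;
  orig : session -> node;
  dest : session -> node;
  rate : session -> R;
  Dcost : node -> node -> R -> R -> R;
  Cfun : R -> R;
  Pbar : node -> R;
  noise : node -> R;
  gain : node -> node -> R }.

(* The decision variables are meaningful on edges only; their values at pairs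
   (i, j) that are not edges are never used. *)
Record vars (R : realType) (net : network R) := Vars {
  phi : session net -> node net -> node net -> R;
  eta : node net -> node net -> R;
  gam : node net -> R }.

Section JOPR.
Context {R : realType} (net : network R).
Implicit Types (v : vars net) (w : session net) (i j m n : node net).

Definition network_ok : Prop :=
  [/\ forall i j, connect (@edge R net) i j,
      forall w, 0 < rate w,
      forall i, 1 < Pbar i,
      forall i, 0 < noise i
    & forall m j, 0 <= gain m j].

Definition link_cost_ok (f : R -> R -> R) : Prop :=
  [/\ C2_on_X f,
      forall c x, Xdom (c, x) -> 0 <= f c x,
      forall c x, Xdom (c, x) -> dC f c x < 0 /\ 0 < dF f c x,
      forall c x, Xdom (c, x) -> 0 <= dC (dC f) c x /\ 0 <= dF (dF f) c x
    & forall c, 0 < c -> f c x @[x --> c^'-] --> +oo].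

Definition link_costs_ok : Prop :=
  forall i j, edge i j -> link_cost_ok (@Dcost R net i j).

Definition capacity_ok : Prop :=
  let C := Cfun net in
  [/\ {in `]0, +oo[ &, {homo C : x y / x < y}},
      convex_function (`]0, +oo[%classic : set R) (fun x : R => - C x),
      forall x, 0 < x -> derivable C x 1 /\ derivable (derive1 C) x 1,
      {in `]0, +oo[, continuous (derive1n 2 C)}
    & forall x, 0 < x -> derive1n 2 C x * x + derive1 C x <= 0].

Definition routing_feasible v : Prop :=
  forall w i,
    (forall j, edge i j -> 0 <= phi v w i j) /\
    (if i == dest w then forall j, edge i j -> phi v w i j = 0
     else \sum_(j | edge i j) phi v w i j = 1).

Definition rate_eqs v w (t : node net -> R) : Prop :=
  forall i, t i = if i == orig w then rate w
                  else \sum_(j | edge j i) t j * phi v w j i.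

Definition node_rate v w : node net -> R := xget (fun=> 0) [set t | rate_eqs v w t].

(* The rate equations are implicit (routing may contain loops), so they define
   the rates only if they have exactly one solution.  Moreover t_i(w) is the
   total rate of session w at node i; its value r_w at the origin thus says that
   no traffic of session w comes back to its origin.  Both parts hold for every
   loop-free routing.  Without the second one, traffic returned to its origin
   would vanish from the network. *)
Definition rates_determined v : Prop :=
  forall w, (exists! t, rate_eqs v w t) /\
    \sum_(j | edge j (orig w)) node_rate v w j * phi v w j (orig w) = 0.

Definition power_feasible v : Prop :=
  forall i, [/\ forall j, edge i j -> 0 <= eta v i j,
                \sum_(j | edge i j) eta v i j = 1
              & gam v i <= 1].

Definition feasible v : Prop :=
  [/\ routing_feasible v, rates_determined v & power_feasible v].

Definition flow v i j : R := \sum_w node_rate v w i * phi v w i j.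

Definition npower v i : R := Pbar i `^ gam v i.

Definition lpower v i j : R := npower v i * eta v i j.

Definition IN v i j : R :=
  gain i j * (\sum_(k | edge i k && (k != j)) lpower v i k) +
  \sum_(m | m != i) gain m j * npower v m + noise j.

Definition SINR v i j : R := gain i j * lpower v i j / IN v i j.

(* [Cfun] is specified on (0, +oo) only; a link without received power has
   capacity 0, hence infinite cost. *)
Definition capacity v i j : R :=
  if 0 < SINR v i j then Cfun net (SINR v i j) else 0.

Definition link_cost i j (c x : R) : \bar R :=
  if 0 <= x < c then (Dcost i j c x)%:E else +oo%E.

Definition total_cost v : \bar R :=
  (\sum_i \sum_(j | edge i j) link_cost i j (capacity v i j) (flow v i j))%E.

Definition JOPR_solution v : Prop :=
  feasible v /\ forall v', feasible v' -> (total_cost v <= total_cost v')%E.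

Definition dDdC v i j : R := dC (Dcost i j) (capacity v i j) (flow v i j).

Definition dDdF v i j : R := dF (Dcost i j) (capacity v i j) (flow v i j).

Definition dphi v (q : session net -> node net -> R) w i j : R :=
  dDdF v i j + q w j.

(* [q w i] plays the role of dD/dr_i(w). *)
Definition marginal_cost v (q : session net -> node net -> R) : Prop :=
  forall w i, q w i = if i == dest w then 0
                      else \sum_(j | edge i j) phi v w i j * dphi v q w i j.

Definition deta v i j : R :=
  dDdC v i j * (derive1 (Cfun net) (SINR v i j) * gain i j / IN v i j) *
  (1 + SINR v i j).

Definition dgam v i : R :=
  npower v i *
  (- (\sum_m \sum_(n | edge m n)
        dDdC v m n * (derive1 (Cfun net) (SINR v m n) * gain m n * gain i n *
                      lpower v m n / IN v m n ^+ 2)) +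
   \sum_(j | edge i j) deta v i j * eta v i j).

Definition routing_condition_at v (q : session net -> node net -> R) w i : Prop :=
  exists lam : R, forall j, edge i j ->
    (0 < phi v w i j -> dphi v q w i j = lam) /\
    (phi v w i j = 0 -> lam <= dphi v q w i j).

Definition power_condition v : Prop :=
  forall i, (forall j, edge i j -> 0 < eta v i j) /\
    exists nu : R,
      [/\ forall j, edge i j -> deta v i j = nu,
          gam v i < 1 -> dgam v i / npower v i = 0
        & gam v i = 1 -> dgam v i / npower v i <= 0].

Definition link_costs_convex : Prop :=
  forall i j, edge i j ->
    convex_function Xdom (fun p : R * R => Dcost i j p.1 p.2).

End JOPR.

(* Main.v *)
(** Routing, necessity.  A session is perturbed in the space of its link flows
    [t_i(w) phi_ij(w)], mixing it with the flow sent along shortest paths for the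
    link lengths [dD_ij/dF_ij].  Perturbing a single [phi_ij(w)] would not do: it
    may send traffic back to the origin, which is infeasible.  Optimality then
    forces every used link onto a shortest path, and [dD/dr_i(w)] is the
    distance to the destination at nodes that carry traffic and at least this
    distance elsewhere.

    Power control, necessity.  In the link powers [P_ij] the feasible set is
    [P_ij > 0], [sum_j P_ij <= Pbar_i], and the derivative of the cost with respect to
    [P_ij] is [deta_ij] plus a marginal interference cost depending on [i] only.

    Sufficiency.  [ln IN_ij] is convex in the logarithms of the powers, and
    [C(exp u)] is concave in [u] because [x C''(x) + C'(x) <= 0]; with the joint
    convexity of [D_ij] the first-order conditions give a global lower bound. *)

(* Node rates are only implicit: they are the unique solution of a linear system, and a variation of
   the routing has to preserve this uniqueness. For a substochastic matrix, uniqueness is equivalent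
   to the absence of a trap, a condition on row sums and supports that, unlike invertibility, can be
   followed through a mixture of two flows. Two matrices occur: the rate equations ignore what
   enters the origin, whereas the recursion for the marginal costs uses every routing fraction.
   Since no traffic returns to the origin, trap-freeness passes from the first matrix to the second,
   and this makes the marginal costs exist even when the routing has loops.

   A link flow may be 0, on the boundary of the domain of the link cost. Variations are therefore
   taken for [e > 0] tending to 0, and the tangent inequality for a convex cost cannot rest on
   two-sided differentiability. Link powers, in contrast, cannot vanish at finite cost, because the
   capacity would be 0; only the power budgets restrict their variations. *)
Require Import Defs.
From mathcomp Require Import all_boot all_order all_algebra.
From mathcomp Require Import all_classical all_reals all_analysis.
From mathcomp Require Import ring lra.

Set Implicit Arguments.
Unset Strict Implicit.
Unset Printing Implicit Defensive.

Import Order.TTheory GRing.Theory Num.Theory.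
Import numFieldNormedType.Exports.

Local Open Scope classical_set_scope.
Local Open Scope ring_scope.

(** * Substochastic matrices *)

Section Substochastic.
Context {R : realType} {N : finType}.
Implicit Types (M : N -> N -> R) (x y : N -> R) (S : {set N}).

Lemma psum0_eq0 (P : pred N) (F : N -> R) :
  (forall i, P i -> 0 <= F i) -> \sum_(i | P i) F i <= 0 ->
  forall i, P i -> F i = 0.
Proof.
move=> F0 sF i Pi; have s0 : \sum_(i | P i) F i = 0 by apply/le_anti; rewrite sF sumr_ge0.
exact: (psumr_eq0P F0 s0 Pi).
Qed.

Definition substochastic M :=
  (forall i j, 0 <= M i j) /\ (forall i, \sum_j M i j <= 1).

(* No set of states retains all its mass: [1 - M] is then invertible, with a
   nonnegative inverse. *)
Definition trap_free M :=
  forall S, S != finset.set0 -> exists2 i, i \in S & \sum_(j in S) M i j < 1.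

Lemma linear_system_solvable (K : N -> N -> R) (b : N -> R) :
  (forall x, (forall i, \sum_j K i j * x j = 0) -> forall i, x i = 0) ->
  exists x, forall i, \sum_j K i j * x j = b i.
Proof.
move=> Kinj; pose A : 'M[R]_#|N| := \matrix_(i, j) K (enum_val j) (enum_val i).
have sumE (F : N -> R) : \sum_j F j = \sum_(k < #|N|) F (enum_val k).
  by rewrite (reindex (@enum_val N predT)) //=; exact/onW_bij/enum_val_bij.
have /row_freeP[B AB] : row_free A.
  rewrite -kermx_eq0; apply/eqP/row_matrixP => k; rewrite row0.
  set u := row k _; have uA : u *m A = 0.
    by rewrite /u -row_mul mulmx_ker row0.
  have u0 : forall i, u 0 (enum_rank i) = 0.
    apply: (Kinj (fun i => u 0 (enum_rank i))) => i.
    have := congr1 (fun v : 'rV_#|N| => v 0 (enum_rank i)) uA.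
    rewrite [in RHS]mxE mxE => uA0; rewrite -[RHS]uA0 sumE.
    by apply: eq_bigr => j _; rewrite !mxE enum_rankK enum_valK mulrC.
  by apply/rowP => l; have := u0 (enum_val l); rewrite enum_valK => ->; rewrite !mxE.
pose v := (\row_j b (enum_val j)) *m B.
have vA : v *m A = \row_j b (enum_val j).
  by rewrite -mulmxA (mulmx1C AB) mulmx1.
exists (fun i => v 0 (enum_rank i)) => i.
have := congr1 (fun v : 'rV_#|N| => v 0 (enum_rank i)) vA.
rewrite [in RHS]mxE enum_rankK mxE => <-; rewrite sumE.
by apply: eq_bigr => j _; rewrite !mxE enum_rankK enum_valK mulrC.
Qed.

(** Maximum principle: at a positive maximum the inequality forces each row to put its mass on other
    maximizers and to lose none of it, so the set of maximizers would be a trap. *)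
Lemma trap_free_max M x : substochastic M -> trap_free M ->
  (forall i, 0 < x i -> x i <= \sum_j M i j * x j) -> forall i, x i <= 0.
Proof.
move=> [M0 M1] Mtf xM k; rewrite leNgt; apply/negP => xk.
have [m _ mmax] := @Order.TotalTheory.arg_maxP _ R N k xpredT x isT.
have {}mmax j : x j <= x m by exact: mmax.
have xm : 0 < x m by exact: lt_le_trans xk (mmax k).
have /Mtf[i] : [set i | x i == x m]%SET != finset.set0.
  by apply/set0Pn; exists m; rewrite inE.
set S := [set i | _]%SET; rewrite inE => /eqP xi.
apply/negP; rewrite -leNgt.
have := xM i; rewrite xi => /(_ xm) le1.
have z0 : forall j, xpredT j -> M i j * (x m - x j) = 0.
  apply: psum0_eq0 => [j _|]; first by rewrite mulr_ge0// subr_ge0 mmax.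
  under eq_bigr do rewrite mulrBr.
  rewrite sumrB -mulr_suml subr_le0; apply: le_trans le1.
  by rewrite ler_piMl// ltW.
have z1 j : j \notin S -> M i j = 0.
  rewrite inE => /negbTE xj; move/eqP: (z0 j isT).
  by rewrite mulf_eq0 subr_eq0 (eq_sym (x m)) xj orbF => /eqP.
have eS : \sum_(j in S) M i j = \sum_j M i j.
  by rewrite [RHS](bigID (mem S)) /= [X in _ + X]big1 ?addr0// => j /z1.
have : x m <= (\sum_j M i j) * x m.
  apply: le_trans le1 _; rewrite mulr_suml ler_sum// => j _.
  by rewrite ler_wpM2l// mmax.
by rewrite eS ler_pMl.
Qed.

(** Sum the inequality over the support of [y]: one row of the support loses mass there, so the
    total would be smaller than itself. *)
Lemma trap_free_left_subinvariant M y : substochastic M -> trap_free M ->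
  (forall j, 0 <= y j) -> (forall j, y j <= \sum_i y i * M i j) ->
  forall j, y j = 0.
Proof.
move=> [M0 M1] Mtf y0 yM.
set S := [set i | 0 < y i]%SET.
have [S0 j|/[dup] Sn0 /Mtf[k kS kM]] := eqVneq S finset.set0.
  apply/le_anti; rewrite y0 andbT leNgt; apply/negP => yj.
  by have : j \in S; [rewrite inE | rewrite S0 inE].
have : \sum_(j in S) y j < \sum_(j in S) y j; last by rewrite ltxx.
apply: (@le_lt_trans _ _ (\sum_(j in S) \sum_(i in S) y i * M i j)).
  apply: ler_sum => j _; apply: le_trans (yM j) _.
  rewrite (bigID (mem S)) /= [X in _ + X]big1 ?addr0// => i.
  rewrite inE -leNgt => yi; suff -> : y i = 0 by rewrite mul0r.
  by apply/le_anti; rewrite y0 yi.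
rewrite exchange_big /= (bigD1 k)//= [ltRHS](bigD1 k)//=.
rewrite -mulr_sumr; apply: ltr_leD.
  by rewrite gtr_pMr//; move: kS; rewrite inE.
apply: ler_sum => i /andP[_ _]; rewrite -mulr_sumr ler_piMr//.
apply: le_trans (M1 i); rewrite [leRHS](bigID (mem S)) /= lerDl sumr_ge0//.
Qed.

(** Through this lemma the assumed uniqueness of the node rates becomes a statement about traps. *)
Lemma trap_free_of_left_injective M : substochastic M ->
  (forall y, (forall j, y j = \sum_i y i * M i j) -> forall j, y j = 0) ->
  trap_free M.
Proof.
move=> [M0 M1] inj S /set0Pn[k kS]; apply: contrapT => nS.
have rowS i : i \in S -> 1 <= \sum_(j in S) M i j.
  by move=> iS; rewrite leNgt; apply/negP => lt1; apply: nS; exists i.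
have Mout i j : i \in S -> j \notin S -> M i j = 0.
  move=> iS; apply: (@psum0_eq0 (fun j => j \notin S)) => //.
  have := M1 i; rewrite (bigID (mem S)) /= => le1; have := rowS i iS; lra.
have Mrow i : i \in S -> \sum_(j in S) M i j = 1.
  move=> iS; apply/le_anti; rewrite rowS// andbT.
  by apply: le_trans (M1 i); rewrite [leRHS](bigID (mem S)) /= lerDl sumr_ge0.
(* The rows outside the trap are replaced by unit rows: the indicator of [S] is
   then in the right kernel, and the left kernel is unchanged. *)
pose K i j : R := (i == j)%:R - (if i \in S then M i j else 0).
have yK (y : N -> R) j :
    \sum_i K i j * y i = y j - \sum_(i in S) y i * M i j.
  rewrite /K; under eq_bigr do rewrite mulrBl.
  rewrite sumrB (bigD1 j)//= eqxx mul1r big1 ?addr0; last first.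
    by move=> i /negbTE ->; rewrite mul0r.
  congr (_ - _); rewrite [RHS]big_mkcond /=; apply: eq_bigr => i _.
  by case: ifP; rewrite ?mul0r// mulrC.
have [|y yS] := @linear_system_solvable (fun j i => K i j)
  (fun j => (j \in S)%:R).
  move=> y y0; apply: inj => j.
  have yout i : i \notin S -> y i = 0.
    move=> iS; have := y0 i; rewrite yK big1 ?subr0// => l lS.
    by rewrite Mout ?mulr0.
  move: (y0 j) => /eqP; rewrite yK subr_eq0 => /eqP ->.
  rewrite [RHS](bigID (mem S)) /= [X in _ = _ + X]big1 ?addr0// => i /yout ->.
  by rewrite mul0r.
(* Rows in [S] have sum 1 inside [S], so the left side of the solved system sums to 0 over [S],
   whereas its right side, the indicator, sums to a positive number. *)
have : \sum_(j in S) ((j \in S)%:R : R) = 0.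
  under eq_bigr do rewrite -yS yK.
  rewrite sumrB exchange_big /= -[X in _ - X = _]/(\sum_(i in S) _).
  under [X in _ - X]eq_bigr => i iS do rewrite -mulr_sumr Mrow// mulr1.
  by rewrite subrr.
rewrite (bigD1 k)//= kS => /eqP; rewrite gt_eqF// ltr_pwDl// sumr_ge0//.
Qed.

Lemma trap_free_right_solvable M (b : N -> R) : substochastic M -> trap_free M ->
  exists x, forall i, x i = b i + \sum_j M i j * x j.
Proof.
move=> Mss Mtf.
have KE x i : \sum_j ((i == j)%:R - M i j) * x j = x i - \sum_j M i j * x j.
  under eq_bigr do rewrite mulrBl; rewrite sumrB; congr (_ - _).
  rewrite (bigD1 i)//= eqxx mul1r big1 ?addr0// => j.
  by rewrite eq_sym => /negbTE ->; rewrite mul0r.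
have [|x xb] := @linear_system_solvable (fun i j => (i == j)%:R - M i j) b.
  move=> x x0 i; have xM j : x j = \sum_l M j l * x l.
    by apply/eqP; rewrite -subr_eq0 -KE x0.
  apply/le_anti/andP; split.
    by apply: (trap_free_max Mss Mtf) => j _; rewrite -xM.
  rewrite -oppr_le0; apply: (trap_free_max Mss Mtf (x := fun i => - x i)) => j _.
  by rewrite [X in - X]xM -sumrN; under [leRHS]eq_bigr do rewrite mulrN.
by exists x => i; rewrite -xb KE subrK.
Qed.

Lemma trap_free_left_injective M y : substochastic M -> trap_free M ->
  (forall j, y j = \sum_i y i * M i j) -> forall j, y j = 0.
Proof.
move=> Mss Mtf yM j; apply/normr0_eq0.
apply: (trap_free_left_subinvariant Mss Mtf (y := fun j => `|y j|)) => // l.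
rewrite [in leLHS]yM; apply: le_trans (ler_norm_sum _ _ _) _.
by apply: ler_sum => i _; rewrite normrM (ger0_norm (Mss.1 _ _)).
Qed.

Lemma trap_free_left_solvable M (b : N -> R) : substochastic M -> trap_free M ->
  exists y, forall j, y j = b j + \sum_i y i * M i j.
Proof.
move=> Mss Mtf.
have KE y j : \sum_i ((i == j)%:R - M i j) * y i = y j - \sum_i y i * M i j.
  under eq_bigr do rewrite mulrBl; rewrite sumrB; congr (_ - _).
    rewrite (bigD1 j)//= eqxx mul1r big1 ?addr0// => i.
    by move=> /negbTE ->; rewrite mul0r.
  by apply: eq_bigr => i _; rewrite mulrC.
have [|y yb] := @linear_system_solvable (fun j i => (i == j)%:R - M i j) b.
  move=> y y0; apply: (trap_free_left_injective Mss Mtf) => j.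
  by apply/eqP; rewrite -subr_eq0 -KE y0.
by exists y => j; rewrite -yb KE subrK.
Qed.

(** The negative part of [y] is subinvariant, hence zero. *)
Lemma trap_free_left_ge0 M (b y : N -> R) : substochastic M -> trap_free M ->
  (forall j, 0 <= b j) -> (forall j, y j = b j + \sum_i y i * M i j) ->
  forall j, 0 <= y j.
Proof.
move=> Mss Mtf b0 yM j.
pose n j := Num.max 0 (- y j).
suff n0 : n j = 0.
  by rewrite -oppr_le0 -[leRHS]n0 le_max lexx orbT.
apply: (trap_free_left_subinvariant Mss Mtf (y := n)) => [l|l].
  by rewrite le_max lexx.
rewrite ge_max; apply/andP; split.
  by apply: sumr_ge0 => i _; rewrite mulr_ge0 ?Mss.1// le_max lexx.
rewrite yM opprD -sumrN; apply: (@le_trans _ _ (\sum_i - (y i * M i l))).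
  by rewrite gerDr oppr_le0.
apply: ler_sum => i _; rewrite -mulNr ler_wpM2r ?Mss.1//.
by rewrite le_max lexx orbT.
Qed.

End Substochastic.

(** * Routing of a single session *)

Section Routing.
Context {R : realType} {N : finType}.
Variables (E : rel N) (o dst : N) (r : R).
Hypothesis r_gt0 : 0 < r.
Implicit Types (p M : N -> N -> R) (t q d : N -> R) (S : {set N}).

(** In this form a trap is a closed set of full rows, so that it can be compared between routings
    with related supports. *)
Lemma trap_freeP M : substochastic M ->
  trap_free M <-> forall S, (forall i, i \in S -> \sum_j M i j = 1 /\
    forall j, M i j != 0 -> j \in S) -> S = finset.set0.
Proof.
move=> [M0 M1]; split=> [Mtf S clS|noS S Sn0].
  apply/eqP; apply: contraT => /Mtf[i iS].
  have [Mi Mout] := clS i iS; rewrite -Mi [ltRHS](bigID (mem S)) /=.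
  rewrite [X in _ + X]big1 ?addr0 ?ltxx// => j.
  by apply: contraNeq => /Mout.
apply: contrapT => ntrap; move/eqP: Sn0; apply; apply: noS => i iS.
have le1 : 1 <= \sum_(j in S) M i j.
  by rewrite leNgt; apply/negP => ?; apply: ntrap; exists i.
have := M1 i; rewrite (bigID (mem S)) /= => geM.
have out j : j \notin S -> M i j = 0.
  by apply: (@psum0_eq0 _ _ (fun j => j \notin S)) => //; lra.
split; last by move=> j; apply: contra_neqT => /out.
rewrite [X in _ + X]big1 ?addr0//.
by apply/le_anti; rewrite le1 andbT; apply: le_trans geM; rewrite lerDl sumr_ge0.
Qed.

Definition routing p :=
  [/\ forall i j, 0 <= p i j, forall i j, ~~ E i j -> p i j = 0
    & forall i, \sum_j p i j = (i != dst)%:R].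

(* The rate equation at the origin is [t o = r], whatever enters the origin. *)
Definition cut_col p i j : R := if j == o then 0 else p i j.

(** Feasibility of one session, with the uniqueness of the rates replaced by trap-freeness and the
    vanishing return flow split into its nonnegative terms. [carried_node_rate] and
    [carried_feasible] translate in the two directions. *)
Definition carries p t :=
  [/\ routing p, trap_free (cut_col p),
      forall j, t j = (if j == o then r else 0) + \sum_i t i * cut_col p i j
    & forall j, t j * p j o = 0].

Lemma routing_substochastic p : routing p -> substochastic p.
Proof. by move=> [p0 _ p1]; split=> // i; rewrite p1 lern1 leq_b1. Qed.

Lemma cut_substochastic p : routing p -> substochastic (cut_col p).
Proof.
move=> /routing_substochastic[p0 p1]; split=> [i j|i].
  by rewrite /cut_col; case: ifP.
by apply: le_trans (p1 i); apply: ler_sum => j _; rewrite /cut_col; case: ifP.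
Qed.

Lemma routing_dest p j : routing p -> p dst j = 0.
Proof.
move=> [p0 _ p1]; apply: (@psum0_eq0 _ _ predT) => //.
by rewrite p1 eqxx.
Qed.

(** * Support and conservation of a session flow *)

Section Carried.
Context {p t} (pt : carries p t).

Let rp : routing p. Proof. by case: pt. Qed.
Let p_ge0 i j : 0 <= p i j. Proof. by case: rp. Qed.

Lemma carried_ge0 j : 0 <= t j.
Proof.
case: pt => _ ctf tE _.
apply: (trap_free_left_ge0 (cut_substochastic rp) ctf _ tE) => k.
by case: ifP => // _; exact: ltW.
Qed.

Lemma carried_orig : t o = r.
Proof.
case: pt => _ _ -> _; rewrite eqxx big1 ?addr0// => i _.
by rewrite /cut_col eqxx mulr0.
Qed.

Lemma carried_no_return i : t i != 0 -> p i o = 0.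
Proof.
case: pt => _ _ _ /(_ i)/eqP; rewrite mulf_eq0 => + /negbTE ti.
by rewrite ti => /eqP.
Qed.

Lemma carried_succ i j : t i != 0 -> p i j != 0 -> t j != 0.
Proof.
move=> ti pij; have jo : j != o.
  by apply: contra_neq pij => ->; exact: carried_no_return.
rewrite gt_eqF//; case: pt => _ _ -> _; rewrite (negbTE jo) add0r (bigD1 i)//=.
rewrite ltr_pwDl//.
  by rewrite /cut_col (negbTE jo) mulr_gt0// lt_def ?ti ?pij ?carried_ge0 ?p_ge0.
apply: sumr_ge0 => k _; rewrite mulr_ge0 ?carried_ge0//.
by case: (cut_substochastic rp).
Qed.

(** Traffic cannot be kept away from the destination. Nodes with traffic never route to [o], so [S]
    without [o] is closed for [cut_col p] and must be empty; then [o] alone would have to send its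
    unit mass to itself. *)
Lemma carried_support_not_closed S :
  (forall i, i \in S -> [/\ i != dst, t i != 0 & forall j, p i j != 0 -> j \in S])
  -> S = finset.set0.
Proof.
move=> clS; have pS i : i \in S -> \sum_j p i j = 1.
  by case/clS => id _ _; case: rp => _ _ ->; rewrite id.
have /eqP So : (S :\ o)%SET == finset.set0.
  apply/eqP; case: pt => _ /(trap_freeP (cut_substochastic rp)) noS _ _.
  apply: noS => i /setD1P[_ iS]; have [id ti succ] := clS i iS; split.
    rewrite -(pS i iS); apply: eq_bigr => j _.
    by rewrite /cut_col; case: eqP => // ->; rewrite carried_no_return.
  move=> j; rewrite /cut_col in_setD1; case: (eqVneq j o) => [_|_ /succ//].
  by rewrite eqxx.
apply/eqP; apply: contraT => /set0Pn[k kS].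
have oS : o \in S.
  have [<-//|ko] := eqVneq k o.
  have : k \in (S :\ o)%SET by rewrite in_setD1 ko.
  by rewrite So inE.
have [_ to succ] := clS o oS.
have := pS o oS; rewrite big1 => [/eqP|j _]; first by rewrite eq_sym oner_eq0.
have [->|jo] := eqVneq j o; first exact: carried_no_return.
apply/eqP; apply: contraT => /succ jS.
have : j \in (S :\ o)%SET by rewrite in_setD1 jo.
by rewrite So inE.
Qed.

(** By the previous lemma a trap of [p] contains no node with traffic, in particular not the origin.
    Its rows then vanish in column [o], and it is already a trap of [cut_col p]. *)
Lemma carried_trap_free : trap_free p.
Proof.
apply/(trap_freeP (routing_substochastic rp)) => S clS.
have Sd i : i \in S -> i != dst.
  move=> /clS[]; case: rp => _ _ -> /eqP; case: (i != dst) => //.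
  by rewrite eq_sym oner_eq0.
have S1 : [set i in S | t i != 0]%SET = finset.set0.
  apply: carried_support_not_closed => i; rewrite inE => /andP[iS ti].
  split=> //; first exact: Sd.
  move=> j pij; rewrite inE (carried_succ ti pij) andbT.
  by have [_] := clS i iS; exact.
have oS : o \notin S.
  apply/negP => oS; have : o \in [set i in S | t i != 0]%SET.
    by rewrite inE oS carried_orig gt_eqF.
  by rewrite S1 inE.
case: pt => _ /(trap_freeP (cut_substochastic rp)) noS _ _.
apply: noS => i iS; have [si succ] := clS i iS; split.
  rewrite -si; apply: eq_bigr => j _; rewrite /cut_col; case: eqP => // ->.
  by apply/esym/eqP; apply: contraNT oS => /succ.
by move=> j; rewrite /cut_col; case: ifP => [|_ /succ//]; rewrite eqxx.
Qed.

(** Flow conservation tested against a potential: outflow minus inflow is [r] at the origin and 0 at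
    every other node except the destination, where [f] vanishes. Duality with shortest paths rests
    on this identity. *)
Lemma carried_balance (f : N -> R) : f dst = 0 ->
  \sum_i \sum_j t i * p i j * (f i - f j) = r * f o.
Proof.
move=> fd; under eq_bigr do under eq_bigr do rewrite mulrBr.
under eq_bigr do rewrite sumrB.
rewrite sumrB [X in _ - X]exchange_big /=.
have -> : \sum_i \sum_j t i * p i j * f i = \sum_i t i * f i.
  apply: eq_bigr => i _; rewrite -mulr_suml -mulr_sumr.
  case: rp => _ _ ->; case: eqP => [->|_]; first by rewrite fd !mulr0.
  by rewrite mulr1.
rewrite -sumrB (bigD1 o)//= [X in _ + X]big1 ?addr0.
  rewrite -mulr_suml big1 ?mul0r ?subr0 ?carried_orig// => i _.
  by case: pt.
move=> j jo; rewrite -mulr_suml; case: pt => _ _ /(_ j) + _.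
rewrite (negbTE jo) add0r => tj; rewrite [in t j * _]tj; apply/eqP.
rewrite subr_eq0; apply/eqP; congr (_ * _); apply: eq_bigr => i _.
by rewrite /cut_col (negbTE jo).
Qed.

End Carried.

(** Link flows, unlike routing fractions, can be averaged: the rate equation and the absence of
    returning traffic are linear in them. Trap-freeness is the nonlinear part. *)
Lemma carries_mix p t p' t' (e : R) : carries p t -> carries p' t' ->
  0 <= e <= 1 ->
  exists p2 t2, carries p2 t2 /\
    forall i j, t2 i * p2 i j = (1 - e) * (t i * p i j) + e * (t' i * p' i j).
Proof.
move=> pt pt' /andP[e0 e1].
have [rp ctf tE nr] := pt; have [rp' ctf' tE' nr'] := pt'.
have t0 := carried_ge0 pt; have t0' := carried_ge0 pt'.
have e1' : 0 <= 1 - e by lra.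
pose u i := (1 - e) * t i + e * t' i.
pose s i j := (1 - e) * (t i * p i j) + e * (t' i * p' i j).
pose p2 i j := if u i == 0 then p i j else s i j / u i.
have a0 i : 0 <= (1 - e) * t i by rewrite mulr_ge0.
have a0' i : 0 <= e * t' i by rewrite mulr_ge0.
have u0 i : 0 <= u i by rewrite addr_ge0.
have sE i j : s i j = (1 - e) * t i * p i j + e * t' i * p' i j.
  by rewrite /s !mulrA.
have up2 i j : u i * p2 i j = s i j.
  rewrite /p2; case: ifPn => [/eqP ui|ui]; last by rewrite mulrC divfK.
  have [ti ti'] : (1 - e) * t i = 0 /\ e * t' i = 0.
    by move: (a0 i) (a0' i) ui; rewrite /u; split; lra.
  by rewrite ui mul0r sE ti ti' !mul0r addr0.
have rp2 : routing p2.
  case: rp rp' => [p0 pE p1] [p0' pE' p1']; split=> [i j|i j ij|i].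
  - rewrite /p2; case: ifP => // _; apply: divr_ge0 => //.
    by rewrite sE addr_ge0 ?mulr_ge0.
  - by rewrite /p2 /s pE// pE'// !mulr0 addr0 mul0r if_same.
  rewrite /p2; case: (u i =P 0) => [_|/eqP ui]; first exact: p1.
  rewrite -mulr_suml; under eq_bigr do rewrite sE.
  by rewrite big_split /= -!mulr_sumr p1 p1' -mulrDl mulrAC mulfV// mul1r.
exists p2, u; split=> //; split=> // [|j|j].
- apply/(trap_freeP (cut_substochastic rp2)) => S clS.
  have Sd i : i \in S -> i != dst.
    move=> /clS[+ _]; apply: contra_eq_neq => ->.
    rewrite big1 ?(eq_sym 0) ?oner_eq0// => j _; rewrite /cut_col.
    by case: ifP => // _; rewrite routing_dest.
  (* A trap cannot meet the support of either flow, and elsewhere [p2] is [p]. *)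
  have aux c pi ti : carries pi ti -> (forall i, 0 <= c * ti i) ->
      (forall i j, c * ti i * pi i j <= u i * p2 i j) ->
      [set i in S | c * ti i != 0]%SET = finset.set0.
    move=> pti c0 le2; have [rpi _ _ _] := pti.
    apply: (carried_support_not_closed pti) => i.
    rewrite inE => /andP[iS cti].
    have tii : ti i != 0 by apply: contra_neq cti => ->; rewrite mulr0.
    have cn : c != 0 by apply: contra_neq cti => ->; rewrite mul0r.
    split=> //; first exact: Sd.
    move=> j pij; rewrite inE; have tij := carried_succ pti tii pij.
    rewrite mulf_neq0// andbT; have [_] := clS i iS; apply.
    have jo : j != o.
      by apply: contra_neq pij => ->; exact: (carried_no_return pti).
    rewrite /cut_col (negbTE jo).
    have : c * ti i * pi i j > 0.
      rewrite mulr_gt0// lt_def ?cti ?c0 ?pij//=; by case: rpi.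
    move=> /lt_le_trans/(_ (le2 i j)).
    by move=> /lt0r_neq0; rewrite mulf_eq0 negb_or => /andP[].
  have p0 i j : 0 <= p i j by case: rp.
  have p0' i j : 0 <= p' i j by case: rp'.
  have S1 := aux _ _ _ pt a0 _; have S2 := aux _ _ _ pt' a0' _.
  have Su i : i \in S -> u i = 0.
    move=> iS; have z1 : (1 - e) * t i = 0.
      apply/eqP; apply: contraT => ti.
      suff : i \in finset.set0 by rewrite inE.
      rewrite -S1 ?inE ?iS ?ti// => k j.
      by rewrite up2 sE lerDl mulr_ge0.
    have z2 : e * t' i = 0.
      apply/eqP; apply: contraT => ti.
      suff : i \in finset.set0 by rewrite inE.
      rewrite -S2 ?inE ?iS ?ti// => k j.
      by rewrite up2 sE lerDr mulr_ge0.
    by rewrite /u z1 z2 addr0.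
  apply: ((trap_freeP (cut_substochastic rp)).1 ctf) => i iS.
  have := clS i iS; rewrite /cut_col /p2; under eq_bigr do rewrite Su// eqxx.
  move=> [-> succ]; split=> // j pij; apply: succ.
  by rewrite Su// eqxx.
- rewrite {1}/u tE tE' !mulrDr addrACA !mulr_sumr -big_split /=; congr (_ + _).
    by case: ifP => _; lra.
  apply: eq_bigr => i _; rewrite /cut_col; case: ifP => _; first by rewrite !mulr0 addr0.
  by rewrite up2.
- by rewrite up2 /s nr nr' !mulr0 addr0.
Qed.

(** * Shortest paths and linear programming duality for one session *)

Section Potential.
Variable w : N -> N -> R.
Hypothesis w_gt0 : forall i j, E i j -> 0 < w i j.
Hypothesis to_dst : forall i, connect E i dst.

(* The distance to the destination is the largest feasible potential. *)
Lemma distance_exists : exists d, [/\ d dst = 0,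
  forall i j, E i j -> i != dst -> d i <= w i j + d j
  & forall i, i != dst -> exists2 j, E i j & d i = w i j + d j].
Proof.
pose pot (f : N -> R) := f dst = 0 /\
  forall i j, E i j -> i != dst -> f i <= w i j + f j.
have pot0 : pot (fun=> 0).
  by split=> // i j /w_gt0/ltW; rewrite addr0.
have potB i : exists B, forall f, pot f -> f i <= B.
  have /connectP[s] := to_dst i; elim: s i => [|k s IH] i /=.
    by move=> _ <-; exists 0 => f [-> _].
  move=> /andP[ik ks] /(IH _ ks)[B fB].
  have [->|id] := eqVneq i dst; first by exists 0 => f [-> _].
  exists (w i k + B) => f pf; apply: le_trans (pf.2 i k ik id) _.
  by rewrite lerD2l fB.
pose V i := [set f i | f in [set f | pot f]].
have supV i : has_sup (V i).
  split; first by exists 0, (fun=> 0).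
  by have [B fB] := potB i; exists B => _ [f pf <-]; exact: fB.
pose d i := sup (V i).
have d_ub f i : pot f -> f i <= d i.
  by move=> pf; apply: sup_upper_bound => //; exists f.
have dpot : pot d.
  split.
    apply/le_anti; rewrite (d_ub (fun=> 0))// andbT.
    by apply: sup_le_ub => [|_ [f [fd _] <-]]; [exists 0, (fun=> 0)|rewrite fd].
  move=> i j ij id; apply: sup_le_ub => [|_ [f pf <-]].
    by exists 0, (fun=> 0).
  by apply: le_trans (pf.2 i j ij id) _; rewrite lerD2l d_ub.
have [dd dle] := dpot.
exists d; split=> // i id.
have [k ik] : exists k, E i k.
  have /connectP[[|k s] /=] := to_dst i; first by move=> _ ed; rewrite ed eqxx in id.
  by move=> /andP[ik _] _; exists k.
have [j ij jmin] :=
  @Order.TotalTheory.arg_minP _ R N k (E i) (fun j => w i j + d j) ik.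
exists j => //; apply/le_anti; rewrite dle//=.
(* Raising [d] at [i] to the best bound offered by its outgoing links leaves a potential, so the
   maximality of [d] makes this bound an equality. *)
pose g l := if l == i then w i j + d j else d l.
have dg l : d l <= g l by rewrite /g; case: eqP => // ->; exact: dle.
suff pg : pot g by have := d_ub g i pg; rewrite /g eqxx.
split; first by rewrite /g eq_sym (negbTE id).
move=> a b ab ad; have [ai|ai] := eqVneq a i; last first.
  by rewrite {1}/g (negbTE ai); apply: le_trans (dle _ _ ab ad) _; rewrite lerD2l.
subst a; have [bi|bi] := eqVneq b i.
  by subst b; rewrite /g eqxx lerDr ltW// w_gt0.
by rewrite /g eqxx (negbTE bi); exact: jmin.
Qed.

(** Every node forwards all its traffic to one next hop on a shortest path. As [d] strictly
    decreases along used links, there is neither a trap nor a return to the origin. *)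
Lemma shortest_path_routing d :
  (forall i, i != dst -> exists2 j, E i j & d i = w i j + d j) ->
  exists p t, carries p t /\ forall i j, p i j != 0 -> d i = w i j + d j.
Proof.
move=> dE.
have /choice[nx nxE] i : exists j, i != dst -> E i j /\ d i = w i j + d j.
  have [->|/dE[j]] := eqVneq i dst; first by exists dst.
  by exists j.
pose p i j : R := ((i != dst) && (j == nx i))%:R.
have rp : routing p.
  split=> [i j|i j ij|i]; first exact: ler0n.
    rewrite /p; case: (eqVneq i dst) => //= /nxE[inx _].
    by case: eqP => // ji; rewrite ji inx in ij.
  rewrite /p (bigD1 (nx i))//= eqxx andbT big1 ?addr0// => j /negbTE ->.
  by rewrite andbF.
have pd i j : p i j != 0 -> d i = w i j + d j.
  rewrite /p pnatr_eq0 eqb0 negbK => /andP[/nxE[_ ->]] /eqP -> //.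
have plt i j : p i j != 0 -> d j < d i.
  move=> pij; rewrite (pd _ _ pij) ltrDr w_gt0//.
  by apply: contraT => nij; case: rp pij => _ /(_ i j nij) ->; rewrite eqxx.
have ctf : trap_free (cut_col p).
  apply/(trap_freeP (cut_substochastic rp)) => S clS; apply/eqP.
  apply: contraT => /set0Pn[k kS].
  have [m mS mmin] := @Order.TotalTheory.arg_minP _ R N k (mem S) d kS.
  have [sm succ] := clS m mS.
  have [j cj] : exists j, cut_col p m j != 0.
    apply: contrapT => /forallNP c0; move: sm; rewrite big1 => [/eqP|j _].
      by rewrite eq_sym oner_eq0.
    by apply/eqP/negPn/negP/c0.
  have := mmin j (succ j cj); rewrite leNgt plt//.
  by move: cj; rewrite /cut_col; case: ifP; rewrite ?eqxx.
have [t tE] := trap_free_left_solvable (fun j => if j == o then r else 0)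
  (cut_substochastic rp) ctf.
have t0 : forall j, 0 <= t j.
  apply: (trap_free_left_ge0 (cut_substochastic rp) ctf _ tE) => j.
  by case: ifP => // _; exact: ltW.
exists p, t; split=> //; split=> // k; apply/eqP; apply: contraT => tpk.
move: tpk; rewrite mulf_eq0 negb_or => /andP[tk /plt dk].
(* A node with traffic that routes to [o] is farther than [o]. The farthest such node with traffic
   must have been fed by a node still farther, a contradiction. *)
pose P i := (t i != 0) && (d o < d i).
have Pk : P k by rewrite /P tk.
have [m /andP[tm dm] mmax] := @Order.TotalTheory.arg_maxP _ R N k P d Pk.
have mo : m != o by apply: contraTneq dm => ->; rewrite ltxx.
have [i] : exists i, t i * cut_col p i m != 0.
  apply: contrapT => /forallNP c0; move: tm; rewrite tE (negbTE mo) add0r.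
  rewrite big1 ?eqxx// => i _; by apply/eqP/negPn/negP/c0.
rewrite /cut_col (negbTE mo) mulf_eq0 negb_or => /andP[ti /plt di].
have /mmax : P i by rewrite /P ti (lt_trans dm).
by move=> /(lt_le_trans di); rewrite ltxx.
Qed.

Lemma optimal_routing_condition p t q : carries p t ->
  (forall p' t', carries p' t' ->
     0 <= \sum_i \sum_j w i j * (t' i * p' i j - t i * p i j)) ->
  (forall i, q i = \sum_j p i j * (w i j + q j)) ->
  forall i j, i != dst -> t i != 0 -> E i j ->
    q i <= w i j + q j /\ (p i j != 0 -> w i j + q j = q i).
Proof.
move=> pt opt qE; have [rp _ _ _] := pt; have [p0 pE p1] := rp.
have t0 := carried_ge0 pt.
have [d [dd dle dE]] := distance_exists.
have [p' [t' [pt' p'd]]] := shortest_path_routing dE.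
have sumsub (f : N -> N -> R) :
    \sum_i \sum_j t i * p i j * f i j = 0 -> (forall i j, 0 <= t i * p i j * f i j)
    -> forall i j, t i * p i j * f i j = 0.
  move=> s0 f0 i j.
  have ri : \sum_j t i * p i j * f i j = 0.
    apply: (psumr_eq0P _ s0) => // k _; exact: sumr_ge0.
  exact: (psumr_eq0P _ ri).
have slack0 i j : 0 <= t i * p i j * (w i j + d j - d i).
  have [ij|/pE ->] := boolP (E i j); last by rewrite mulr0 mul0r.
  have [->|id] := eqVneq i dst; first by rewrite routing_dest// mulr0 mul0r.
  by rewrite !mulr_ge0// subr_ge0 dle.
(* Complementary slackness: by [carried_balance] the sum of these terms is the linear cost of the
   given flow minus that of the shortest-path flow, which optimality makes nonpositive. *)
have slack i j : t i * p i j * (w i j + d j - d i) = 0.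
  apply: (sumsub (fun i j => w i j + d j - d i)) => //.
  apply/le_anti/andP; split; last first.
    by apply: sumr_ge0 => k _; exact: sumr_ge0.
  have -> : \sum_i \sum_j t i * p i j * (w i j + d j - d i) =
      \sum_i \sum_j t i * p i j * w i j - \sum_i \sum_j t i * p i j * (d i - d j).
    rewrite -sumrB; apply: eq_bigr => k _; rewrite -sumrB; apply: eq_bigr => l _.
    by rewrite -mulrBr; congr (_ * _); lra.
  rewrite (carried_balance pt)// -(carried_balance pt' dd) subr_le0 -subr_ge0.
  have := opt _ _ pt'; congr (_ <= _); rewrite -sumrB; apply: eq_bigr => k _.
  rewrite -sumrB; apply: eq_bigr => l _.
  have [->|/p'd ->] := eqVneq (p' k l) 0; lra.
(* [q] is the mean length of the walks that [p] prescribes, so it dominates the distance; the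
   maximum principle covers routings with loops. *)
have qd : forall i, d i - q i <= 0.
  apply: (trap_free_max (routing_substochastic rp) (carried_trap_free pt)) => i.
  move=> dq; have [ei|id] := eqVneq i dst.
    move: dq; rewrite ei dd qE big1 ?subr0 ?ltxx// => j _.
    by rewrite routing_dest// mul0r.
  rewrite [q i]qE -[X in X - _]mul1r.
  have <- : \sum_j p i j = 1 by rewrite p1 id.
  rewrite mulr_suml -sumrB; apply: ler_sum => j _; rewrite -mulrBr.
  have [ij|/pE ->] := boolP (E i j); last by rewrite !mul0r.
  by rewrite ler_wpM2l//; have := dle i j ij id; lra.
have qdT i : t i != 0 -> q i <= d i.
  (* Links are known to be tight only where there is traffic, hence the truncation; [carried_succ]
     keeps the successors inside the support. *)
  move=> ti; pose g k := if t k == 0 then 0 else q k - d k.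
  suff : g i <= 0 by rewrite /g (negbTE ti); lra.
  apply: (trap_free_max (routing_substochastic rp) (carried_trap_free pt)) => k.
  rewrite /g; have [tk|tk] := eqVneq (t k) 0; first by rewrite ltxx.
  have [ek|kd] := eqVneq k dst.
    rewrite ek dd qE big1 ?subr0 ?ltxx// => j _.
    by rewrite routing_dest// mul0r.
  move=> _; rewrite [q k]qE -[X in _ - X]mul1r.
  have <- : \sum_j p k j = 1 by rewrite p1 kd.
  rewrite mulr_suml -sumrB; apply: ler_sum => j _; rewrite -mulrBr.
  have [->|pkj] := eqVneq (p k j) 0; first by rewrite !mul0r.
  rewrite (negbTE (carried_succ pt tk pkj)) ler_wpM2l//.
  have /eqP := slack k j; rewrite mulf_eq0 mulf_eq0 (negbTE tk) (negbTE pkj) /=.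
  by move=> /eqP; lra.
move=> i j id ti ij.
have qle k : E i k -> q i <= w i k + q k.
  by move=> ik; have := dle i k ik id; have := qd k; have := qdT i ti; lra.
split; first exact: qle.
move=> pij; apply/eqP; rewrite -subr_eq0; apply/eqP.
(* [q i] is the [p]-average of numbers that are all at least [q i], so those of positive weight
   equal it. *)
have /eqP : p i j * (w i j + q j - q i) = 0.
  apply: (@psum0_eq0 _ _ predT (fun k => p i k * (w i k + q k - q i))) => // [k _|].
    have [ik|/pE ->] := boolP (E i k); last by rewrite mul0r.
    by rewrite mulr_ge0// subr_ge0 qle.
  under eq_bigr do rewrite mulrBr.
  by rewrite sumrB -qE -mulr_suml p1 id mul1r subrr.
by rewrite mulf_eq0 (negbTE pij) /= => /eqP.
Qed.

(** Averaging identifies [lam] with [q i], which makes [q] a dual potential: the linear cost of the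
    given flow is [r * q o], and that of any other flow is at least this. The other flow may visit
    nodes where [t] vanishes, so the condition is used there too. *)
Lemma routing_condition_sufficient p t p' t' q : carries p t -> carries p' t' ->
  (forall i, q i = \sum_j p i j * (w i j + q j)) ->
  (forall i, i != dst -> exists lam, forall j, E i j ->
     (0 < p i j -> w i j + q j = lam) /\ (p i j = 0 -> lam <= w i j + q j)) ->
  0 <= \sum_i \sum_j w i j * (t' i * p' i j - t i * p i j).
Proof.
move=> pt pt' qE cond; have [[p0 pE p1] _ _ _] := pt.
have [rp' _ _ _] := pt'; have [p0' pE' p1'] := rp'.
have rp : routing p by [].
have qd : q dst = 0.
  by rewrite qE big1// => j _; rewrite routing_dest// mul0r.
have cond' i j : i != dst -> E i j ->
    q i <= w i j + q j /\ (p i j != 0 -> w i j + q j = q i).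
  move=> id ij; have [lam lamE] := cond i id.
  have ql : q i = lam.
    rewrite qE -[RHS]mul1r; have <- : \sum_j p i j = 1 by rewrite p1 id.
    rewrite mulr_suml; apply: eq_bigr => k _.
    have [ik|/pE ->] := boolP (E i k); last by rewrite !mul0r.
    have [->|pk] := eqVneq (p i k) 0; first by rewrite !mul0r.
    by rewrite (lamE k ik).1// lt_def pk p0.
  have [c1 c2] := lamE j ij; rewrite ql; split.
    by have [/c2//|pij] := eqVneq (p i j) 0; rewrite c1// lt_def pij p0.
  by move=> pij; rewrite c1// lt_def pij p0.
rewrite (eq_bigr (fun i => \sum_j (t' i * p' i j * w i j - t i * p i j * w i j))).
  under eq_bigr do rewrite sumrB.
  rewrite sumrB subr_ge0.
  apply: (@le_trans _ _ (r * q o)).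
    rewrite -(carried_balance pt qd); apply/ler_sum => i _; apply/ler_sum => j _.
    have [->|pij] := eqVneq (p i j) 0; first by rewrite mulr0 !mul0r.
    have [ei|id] := eqVneq i dst; first by rewrite ei routing_dest// eqxx in pij.
    have ij : E i j by apply: contraT => /pE pij0; rewrite pij0 eqxx in pij.
    have [_ /(_ pij) <-] := cond' i j id ij; rewrite ler_wpM2l//; last by lra.
    by rewrite mulr_ge0//; exact: (carried_ge0 pt).
  rewrite -(carried_balance pt' qd); apply/ler_sum => i _; apply/ler_sum => j _.
  have [->|pij] := eqVneq (p' i j) 0; first by rewrite mulr0 !mul0r.
  have [ei|id] := eqVneq i dst; first by rewrite ei routing_dest// eqxx in pij.
  have ij : E i j by apply: contraT => /pE' pij0; rewrite pij0 eqxx in pij.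
  have [qle _] := cond' i j id ij; rewrite ler_wpM2l//; last by lra.
  by rewrite mulr_ge0//; exact: (carried_ge0 pt').
by move=> i _; apply: eq_bigr => j _; lra.
Qed.

End Potential.
End Routing.

(** * One-sided derivatives and tangent inequalities *)

Section Calculus.
Context {R : realType}.
Implicit Types (A : set R) (f : R -> R) (F : R -> R -> R).

Lemma cvg_quot_in_curve A f x (D : R) : derivable_in A f x ->
  (\forall e \near (0:R)^'+, A (x + e * D)) ->
  e^-1 * (f (x + e * D) - f x) @[e --> 0^'+] --> derive_in A f x * D.
Proof.
(* The difference quotient excludes the increment 0, so a constant curve is treated apart. *)
move=> df Ae; have [->|D0] := eqVneq D 0.
  rewrite mulr0; under eq_fun do rewrite mulr0 addr0 subrr mulr0.
  exact: cvg_cst.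
have /= qD : quot_in A f x --> derive_in A f x by exact: df.
have eD : e * D @[e --> 0^'+] --> within [set h | A (x + h)] 0^'.
  move=> U /=; rewrite /within /= => U0.
  have [V V0 VU] : exists2 V, nbhs (0:R) V & forall h, V h -> h != 0 -> A (x + h) -> U h.
    by exists (fun h => h != 0 -> A (x + h) -> U h).
  have eD0 : e * D @[e --> (0:R)^'+] --> (0:R).
    apply: cvg_at_right_filter; rewrite -[X in _ --> X](mul0r D).
    by apply: cvgM; [exact: cvg_id|exact: cvg_cst].
  have DV : \forall e \near (0:R)^'+, V (e * D) by exact: (eD0 _ V0).
  rewrite nbhs_simpl /=.
  near=> e; apply: VU; [by near: e| |by near: e].
  by rewrite mulf_neq0// gt_eqF.
have H : D * ((e * D)^-1 * (f (x + e * D) - f x)) @[e --> (0:R)^'+] -->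
    D * derive_in A f x.
  by apply: cvgM; [exact: cvg_cst|exact: (cvg_comp _ _ eD qD)].
rewrite mulrC; apply: cvg_trans H; apply: near_eq_cvg; near=> e.
by rewrite invfM -!mulrA [D * _]mulrCA mulVKf.
Unshelve. all: by end_near. Qed.

Lemma is_derive_in A f x : nbhs x A -> derivable_in A f x ->
  is_derive x 1 f (derive_in A f x).
Proof.
move=> nA df; have qD : quot_in A f x --> derive_in A f x by exact: df.
have A0 : \forall h \near (0:R)^', A (x + h).
  apply: cvg_within; apply: (_ : x + h @[h --> (0:R)] --> x) => //.
  by rewrite -[X in _ --> X]addr0; apply: cvgD; [exact: cvg_cst|exact: cvg_id].
suff H : (fun h => h^-1 *: ((f \o shift x) (h *: 1) - f x)) @ 0^' -->
    derive_in A f x by split; [apply/cvg_ex; eexists; exact: H|exact: cvg_lim].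
move=> U /qD; rewrite /quot_in !nbhs_simpl /= /within /= => H.
apply: filterS2 A0 H => h Ah /(_ Ah).
by rewrite /GRing.scale /= mulr1 (addrC h).
Qed.

Lemma is_derive_quot_right f (l : R) : is_derive (0 : R) 1 f l ->
  e^-1 * (f e - f 0) @[e --> 0^'+] --> l.
Proof.
move=> [df <-]; have /cvg_ex[l' H] := df; rewrite /derive (cvg_lim _ H)//.
move=> U /H /=; rewrite !nbhs_simpl /= => H'.
move: H'; rewrite /dnbhs /at_right /within /=; apply: filterS => e He e0.
by have := He; rewrite /= /GRing.scale /= mulr1 addr0; apply; rewrite gt_eqF.
Qed.

Lemma convex_on_XdomE F c x c' x' (e : R) :
  convex_function Xdom (fun p : R * R => F p.1 p.2) ->
  Xdom (c, x) -> Xdom (c', x') -> 0 <= e <= 1 ->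
  F (c + e * (c' - c)) (x + e * (x' - x)) <= F c x + e * (F c' x' - F c x).
Proof.
move=> Fconv cx cx' /andP[e0 e1].
have := Fconv (Itv01 e0 e1) (c', x') (c, x); rewrite !inE => /(_ cx' cx).
rewrite convRE /conv /= /GRing.scale /= /unstable.onem.
have mixE (a b : R) : e * b + (1 - e) * a = a + e * (b - a) by ring.
by rewrite !mixE.
Qed.

Lemma Xdom_mix (c x c' x' e : R) : Xdom (c, x) -> Xdom (c', x') ->
  0 <= e <= 1 -> Xdom (c + e * (c' - c), x + e * (x' - x)).
Proof.
rewrite /Xdom /= => /andP[x0 xc] /andP[x0' xc'] /andP[e0 e1].
have -> : x + e * (x' - x) = (1 - e) * x + e * x' by ring.
have -> : c + e * (c' - c) = (1 - e) * c + e * c' by ring.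
have e1' : 0 <= 1 - e by lra.
rewrite addr_ge0 ?mulr_ge0//=.
have [e00|en0] := eqVneq e 0; first by rewrite e00 subr0 !mul0r !addr0 !mul1r.
apply: ler_ltD; first by rewrite ler_wpM2l// ltW.
by rewrite ltr_pM2l// lt_def en0.
Qed.

Lemma Xdom_curve (c x D : R) : Xdom (c, x) -> (x = 0 -> 0 <= D) ->
  \forall e \near (0 : R)^'+, Xdom (c, x + e * D).
Proof.
rewrite /Xdom /= => /andP[x0 xc] D0.
have eD0 : x + e * D @[e --> (0:R)^'+] --> x.
  apply: cvg_at_right_filter; rewrite -[X in _ --> X]addr0.
  apply: cvgD; first exact: cvg_cst.
  by rewrite -[X in _ --> X](mul0r D); apply: cvgM; [exact: cvg_id|exact: cvg_cst].
have [x00|xn0] := eqVneq x 0.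
  near=> e; apply/andP; split; last by near: e; apply: (cvgr_lt x).
  by rewrite addr_ge0// mulr_ge0// D0.
near=> e; apply/andP; split; last by near: e; apply: (cvgr_lt x).
by apply: ltW; near: e; apply: (cvgr_gt x) => //; rewrite lt_def xn0.
Unshelve. all: by end_near. Qed.

Lemma convex_tangent_C F c x c' : C1_on_X F ->
  convex_function Xdom (fun p : R * R => F p.1 p.2) ->
  Xdom (c, x) -> Xdom (c', x) -> dC F c x * (c' - c) <= F c' x - F c x.
Proof.
move=> [dF _ _] Fconv cx cx'.
apply: (cvgr_to_le (cvg_quot_in_curve (dF c x cx).1 _)).
  near=> e => /=; have := Xdom_mix cx cx' (e := e); rewrite subrr mulr0 addr0.
  by apply; apply/andP; split=> //; apply: ltW; near: e; exact: nbhs_right_lt.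
near=> e; have e0 : 0 < e by [].
have e1 : e <= 1 by apply: ltW; near: e; exact: nbhs_right_lt.
rewrite ler_pdivrMl//; have := convex_on_XdomE Fconv cx cx' (e := e).
by rewrite subrr mulr0 addr0 ltW// e1 lerBlDl; exact.
Unshelve. all: by end_near. Qed.

(** Only partial derivatives are given, and the one in the flow may be one-sided. The chord is
    therefore cut into a step in [x], handled by its difference quotient, and a step in [c] from the
    displaced point, handled by [convex_tangent_C]; continuity of [dC F] moves the slope back to
    [(c, x)]. *)
Lemma convex_tangent F c x c' x' : C1_on_X F ->
  convex_function Xdom (fun p : R * R => F p.1 p.2) ->
  Xdom (c, x) -> Xdom (c', x') ->
  dC F c x * (c' - c) + dF F c x * (x' - x) <= F c' x' - F c x.
Proof.
move=> C1F Fconv cx cx'; have [dF ctC _] := C1F.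
have xe : \forall e \near (0 : R)^'+, Xdom (c, x + e * (x' - x)).
  by apply: Xdom_curve => // ->; rewrite subr0; move: cx'; rewrite /Xdom => /andP[].
have q2 := cvg_quot_in_curve (dF c x cx).2 xe.
have q1 : dC F c (x + e * (x' - x)) * (c' - c) @[e --> (0:R)^'+] -->
    dC F c x * (c' - c).
  apply: cvgM; last exact: cvg_cst.
  have ce : (c, x + e * (x' - x)) @[e --> (0:R)^'+] --> within Xdom (nbhs (c, x)).
    move=> U /=; rewrite /within /= => cU.
    have : (c, x + e * (x' - x)) @[e --> (0:R)^'+] --> (c, x).
      apply: (@cvg_pair _ _ _ _ (nbhs c) (nbhs x)); first exact: cvg_cst.
      apply: cvg_at_right_filter; rewrite -[X in _ --> X]addr0.
      apply: cvgD; first exact: cvg_cst.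
      rewrite -[X in _ --> X](mul0r (x' - x)).
      by apply: cvgM; [exact: cvg_id|exact: cvg_cst].
    move=> /(_ _ cU); rewrite !nbhs_simpl /= => cU'.
    by apply: filterS2 xe cU' => e Xe; exact.
  have /subspace_continuousP/(_ (c, x) cx) := ctC.
  by move=> H; exact: (cvg_comp _ _ ce H).
apply: (cvgr_to_le (cvgD q1 q2)).
near=> e; have e0 : 0 < e by [].
have e01 : 0 <= e <= 1.
  by rewrite ltW//=; apply: ltW; near: e; exact: nbhs_right_lt.
have Xe : Xdom (c, x + e * (x' - x)) by near: e.
have := convex_on_XdomE Fconv cx cx' e01.
have := convex_tangent_C C1F Fconv Xe (Xdom_mix cx cx' e01).
set xe' := x + _ in Xe *; set ce := c + _.
have -> : ce - c = e * (c' - c) by rewrite /ce; ring.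
move=> h1 h2; rewrite -(ler_pM2l e0) mulrDr mulVKf ?gt_eqF//.
by move: h1 h2; set K := dC F c _; lra.
Unshelve. all: by end_near. Qed.

(** * Concavity of the capacity in the logarithm of the SINR *)

Section Capacity.
Variable C : R -> R.
Hypothesis C_incr : {in `]0, +oo[ &, {homo C : x y / x < y}}.
Hypothesis C_der : forall x : R, 0 < x -> derivable C x 1 /\ derivable (derive1 C) x 1.
Hypothesis C_log : forall x : R, 0 < x -> derive1n 2 C x * x + derive1 C x <= 0.

Lemma capacity_derive1_ge0 (x : R) : 0 < x -> 0 <= derive1 C x.
Proof.
move=> x0; apply: (incr_derive1_ge0_itvy (a := 0) (b0 := false)).
- by move=> y; rewrite inE /= in_itv /= andbT => /C_der[].
- exact: C_incr.
- by rewrite in_itv /= andbT.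
Qed.

Lemma mean_value_pos (f df : R -> R) (x y : R) : 0 < x -> x < y ->
  (forall z : R, 0 < z -> is_derive z 1 f (df z)) ->
  exists2 z, x < z < y & f y - f x = df z * (y - x).
Proof.
move=> x0 xy der; have pos z : z \in `[x, y] -> 0 < z.
  by rewrite in_itv /= => /andP[xz _]; exact: lt_le_trans xz.
have der' z : z \in `]x, y[ -> is_derive z 1 f (df z).
  by move=> /subset_itv_oo_cc /pos /der.
have cf : {within `[x, y], continuous f}.
  by apply: derivable_within_continuous => z /pos /der[].
have [z] := MVT xy der' cf.
by rewrite in_itv /= => xzy zE; exists z.
Qed.

Lemma capacity_elasticity_nincr (x y : R) : 0 < x -> x < y ->
  y * derive1 C y <= x * derive1 C x.
Proof.
move=> x0 xy; rewrite -subr_le0.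
have der (z : R) : 0 < z -> is_derive z 1 (fun u => u * derive1 C u)
    (derive1n 2 C z * z + derive1 C z).
  move=> z0; have dC' : is_derive z 1 (derive1 C) (derive1n 2 C z).
    by split; [exact: (C_der z0).2|rewrite /= -derive1E].
  have := is_deriveM (is_derive_id z 1) dC'.
  by rewrite /GRing.scale /= mulr1 [z * _]mulrC.
have [z /andP[xz _] ->] := mean_value_pos x0 xy der.
by rewrite mulr_le0_ge0 ?subr_ge0 ?(ltW xy)// C_log// (lt_trans x0).
Qed.

(* Since [u * C' u] is nonincreasing, [C] is concave as a function of [ln u]. *)
Lemma capacity_log_tangent (x y : R) : 0 < x -> 0 < y ->
  C y - C x <= derive1 C x * x * (ln y - ln x).
Proof.
move=> x0 y0; set K := derive1 C x * x.
have der (z : R) : 0 < z ->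
    is_derive z 1 (fun u => C u - K * ln u) (derive1 C z - K / z).
  move=> z0; have dC' : is_derive z 1 C (derive1 C z).
    by split; [exact: (C_der z0).1|rewrite /= -derive1E].
  have dln := is_derive1_ln z0.
  have := is_deriveB dC' (is_deriveZ K dln).
  by rewrite /GRing.scale /=.
have derE z : 0 < z -> derive1 C z - K / z = (z * derive1 C z - x * derive1 C x) / z.
  by move=> z0; rewrite /K; field; rewrite gt_eqF.
(* The derivative at [z] has the sign of [z * C' z - x * C' x], so this function is largest at
   [x]. *)
suff : C y - K * ln y <= C x - K * ln x by rewrite mulrBr; lra.
have [xy|yx|->//] := ltgtP x y; rewrite -subr_ge0.
  have [z /andP[xz _]] := mean_value_pos x0 xy der.
  have z0 : 0 < z by exact: lt_trans xz.
  rewrite derE// => zE; rewrite -opprB zE oppr_ge0.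
  rewrite mulr_le0_ge0 ?subr_ge0 ?(ltW xy)// mulr_le0_ge0 ?invr_ge0 ?(ltW z0)//.
  by rewrite subr_le0 capacity_elasticity_nincr.
have [z /andP[yz zx]] := mean_value_pos y0 yx der.
have z0 : 0 < z by exact: lt_trans yz.
rewrite derE// => ->; rewrite mulr_ge0 ?subr_ge0 ?(ltW yx)//.
rewrite mulr_ge0 ?invr_ge0 ?(ltW z0)// subr_ge0.
exact: capacity_elasticity_nincr.
Qed.

End Capacity.

End Calculus.

(** * Optimality in the network *)

Section Linking.
Context {R : realType} (net : network R).
Implicit Types (v : vars net) (w : session net) (i j k l m n : node net).

(** Values of [phi] off the edges are arbitrary; extending by zero lets the matrix results sum over
    all nodes. *)
Definition route v w i j : R := if edge i j then phi v w i j else 0.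

Definition carried v w (t : node net -> R) :=
  carries (@edge R net) (orig w) (dest w) (rate w) (route v w) t.

Lemma sum_route v w (t : node net -> R) i :
  \sum_(j | edge j i) t j * phi v w j i = \sum_j t j * route v w j i.
Proof.
rewrite big_mkcond; apply: eq_bigr => j _; rewrite /route.
by case: ifP => //; rewrite mulr0.
Qed.

Lemma routing_feasibleP v : routing_feasible v <->
  forall w, routing (@edge R net) (dest w) (route v w).
Proof.
split=> [fv w|rv w i].
  split=> [i j|i j /negbTE ij|i]; rewrite /route.
  - by case: ifP => // ij; exact: (fv w i).1.
  - by rewrite ij.
  rewrite -big_mkcond; have [_] := fv w i.
  by case: eqP => [_|_] // p0; rewrite big1.
have [p0 pE p1] := rv w; split=> [j ij|].
  by have := p0 i j; rewrite /route ij.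
case: eqP => [->|/eqP id].
  by move=> j ij; have := routing_dest j (rv w); rewrite /route ij.
by have := p1 i; rewrite id /route -big_mkcond.
Qed.

Lemma rate_eqsP v w (t : node net -> R) : rate_eqs v w t <->
  forall j, t j = (if j == orig w then rate w else 0) +
                  \sum_i t i * cut_col (orig w) (route v w) i j.
Proof.
have E j : (if j == orig w then rate w
            else \sum_(i | edge i j) t i * phi v w i j) =
    (if j == orig w then rate w else 0) +
    \sum_i t i * cut_col (orig w) (route v w) i j.
  rewrite sum_route /cut_col; case: ifP => _; last by rewrite add0r.
  by rewrite big1 ?addr0// => i _; rewrite mulr0.
by rewrite /rate_eqs; split=> tE j; rewrite tE E.
Qed.

Lemma carried_node_rate v w : 0 < rate w ->
  routing_feasible v -> rates_determined v -> carried v w (node_rate v w).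
Proof.
move=> rw0 /routing_feasibleP/(_ w) rv /(_ w)[[t [tE tU]] ret].
have nrE : node_rate v w = t.
  by apply: xget_unique => // s /tU.
rewrite nrE in ret *.
have ctf : trap_free (cut_col (orig w) (route v w)).
  apply: trap_free_of_left_injective (cut_substochastic _ rv) _ => y yE j.
  (* A kernel vector added to the rates gives another solution of the rate equations. *)
  have /tU : rate_eqs v w (fun i => t i + y i).
    move/rate_eqsP: tE => tE; apply/rate_eqsP => i; rewrite tE yE -addrA -big_split.
    by congr (_ + _); apply: eq_bigr => k _; rewrite mulrDl.
  by move=> /(congr1 (fun f => f j))/eqP; rewrite -subr_eq0 opprD addNKr oppr_eq0 => /eqP.
have tE' := (rate_eqsP v w t).1 tE.
have t0 : forall j, 0 <= t j.
  apply: (trap_free_left_ge0 (cut_substochastic _ rv) ctf _ tE') => j.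
  by case: ifP => // _; exact: ltW.
split=> //; move: ret; rewrite sum_route => ret j.
have [p0 _ _] := rv.
by apply: (@psum0_eq0 _ _ predT (fun j => t j * route v w j (orig w))) => //;
  [move=> k _; exact: mulr_ge0|rewrite ret].
Qed.

Lemma carried_feasible v (t : session net -> node net -> R) :
  (forall w, carried v w (t w)) ->
  [/\ routing_feasible v, rates_determined v & node_rate v = t].
Proof.
move=> vt.
have tE w : rate_eqs v w (t w) by case: (vt w) => _ _ /rate_eqsP.
have tU w s : rate_eqs v w s -> s = t w.
  move=> sE; apply/funext => j; apply/eqP; rewrite -subr_eq0; apply/eqP.
  have [rv ctf tE' _] := vt w; move/rate_eqsP: sE => sE.
  apply: (trap_free_left_injective (y := fun j => s j - t w j)
    (cut_substochastic _ rv) ctf) => k.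
  rewrite sE tE' opprD addrACA subrr add0r -sumrB.
  by apply: eq_bigr => i _; rewrite mulrBl.
have nrE : node_rate v = t.
  by apply/funext => w; apply: xget_unique; [exact: tE|exact: tU].
split=> //; first by apply/routing_feasibleP => w; case: (vt w).
move=> w; split; first by exists (t w); split=> // s /tU.
by rewrite nrE sum_route big1// => j _; case: (vt w).
Qed.

Definition finite_cost v := forall i j, edge i j ->
  Xdom (capacity v i j, flow v i j).

Definition real_cost v : R :=
  \sum_i \sum_(j | edge i j) Dcost i j (capacity v i j) (flow v i j).

Lemma total_cost_finite v : finite_cost v -> total_cost v = (real_cost v)%:E.
Proof.
move=> fv; rewrite /total_cost /real_cost -sumEFin; apply: eq_bigr => i _.
rewrite -sumEFin; apply: eq_bigr => j ij.
by have := fv i j ij; rewrite /Xdom /= /link_cost => ->.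
Qed.

Lemma total_cost_ltyP v : (total_cost v < +oo)%E <-> finite_cost v.
Proof.
split=> [|/total_cost_finite ->]; last exact: ltry.
have ny i j c x : link_cost i j c x != -oo%E by rewrite /link_cost; case: ifP.
rewrite ltey => cv i j ij; apply: contrapT => /negP.
rewrite /Xdom /= => nX; move/eqP: cv; apply.
apply/esum_eqyP => [k _|].
  rewrite esum_eqNy; apply/existsP => -[l /andP[_]]; exact/negP.
exists i; split=> //; apply/esum_eqyP => [k _|]; first exact: ny.
by exists j; split=> //; rewrite /link_cost (negbTE nX).
Qed.

(** First-order test shared by routing and power. The link costs are differentiated one at a time
    along the curve, from the right only, as the curve may start at an active constraint. *)
Lemma optimal_variation v (v_ : R -> vars net) (L : node net -> node net -> R) :
  JOPR_solution v -> finite_cost v ->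
  (\forall e \near (0 : R)^'+, feasible (v_ e)) ->
  (forall i j, edge i j ->
     \forall e \near (0 : R)^'+, Xdom (capacity (v_ e) i j, flow (v_ e) i j)) ->
  (forall i j, edge i j ->
     e^-1 * (Dcost i j (capacity (v_ e) i j) (flow (v_ e) i j) -
             Dcost i j (capacity v i j) (flow v i j)) @[e --> (0 : R)^'+] --> L i j) ->
  0 <= \sum_i \sum_(j | edge i j) L i j.
Proof.
move=> [_ opt] fv near_feas near_X dL.
have near_fin : \forall e \near (0 : R)^'+, finite_cost (v_ e).
  apply: filter_forall => i; apply: filter_forall => j.
  have [ij|nij] := boolP (edge i j); last by apply: nearW => e.
  by apply: filterS (near_X i j ij).
have dsum : e^-1 * (real_cost (v_ e) - real_cost v) @[e --> (0 : R)^'+] -->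
    \sum_i \sum_(j | edge i j) L i j.
  under eq_fun do rewrite /real_cost -sumrB mulr_sumr.
  apply: cvg_big => [|i _]; first exact: add_continuous.
  under eq_fun do rewrite -sumrB mulr_sumr.
  by apply: cvg_big => [|j ij]; [exact: add_continuous|exact: dL].
apply: (cvgr_to_ge dsum); near=> e.
apply: mulr_ge0; first by rewrite invr_ge0 ltW.
rewrite subr_ge0 -lee_fin -!total_cost_finite//; last by near: e.
by apply: opt; near: e.
Unshelve. all: by end_near. Qed.

End Linking.

(** * First-order conditions for the routing *)

Section RoutingOptimality.
Context {R : realType} (net : network R).
Hypotheses (hnet : network_ok net) (hD : link_costs_ok net).
Implicit Types (v : vars net) (w : session net) (i j k l m n : node net).

Let rate_gt0 w : 0 < rate w. Proof. by case: hnet. Qed.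

Lemma feasible_carried v w : feasible v -> carried v w (node_rate v w).
Proof. by move=> [rv dv _]; exact: carried_node_rate. Qed.

Lemma node_rate_ge0 v w i : feasible v -> 0 <= node_rate v w i.
Proof. by move=> /(feasible_carried w) vt; exact: (carried_ge0 _ vt). Qed.

Lemma flow_term_ge0 v w i j : feasible v -> edge i j ->
  0 <= node_rate v w i * phi v w i j.
Proof.
move=> fv ij; rewrite mulr_ge0 ?node_rate_ge0//.
by have [rv _ _] := fv; exact: (rv w i).1.
Qed.

Lemma dDdF_gt0 v i j : finite_cost v -> edge i j -> 0 < dDdF v i j.
Proof. by move=> fv ij; have [_ _ /(_ _ _ (fv i j ij))[]] := hD ij. Qed.

Lemma dDdC_lt0 v i j : finite_cost v -> edge i j -> dDdC v i j < 0.
Proof. by move=> fv ij; have [_ _ /(_ _ _ (fv i j ij))[]] := hD ij. Qed.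

Lemma mix_session_routing v w p' t' (e : R) : feasible v ->
  carries (@edge R net) (orig w) (dest w) (rate w) p' t' -> 0 <= e <= 1 ->
  exists v2, [/\ feasible v2, forall i j, capacity v2 i j = capacity v i j
    & forall i j, edge i j -> flow v2 i j =
        flow v i j + e * (t' i * p' i j - node_rate v w i * phi v w i j)].
Proof.
move=> fv pt' e01; have vt := feasible_carried w fv.
have [p2 [t2 [pt2 mixE]]] := carries_mix (rate_gt0 w) vt pt' e01.
pose v2 := Vars (fun w' i j => if w' == w then p2 i j else phi v w' i j)
  (eta v) (gam v).
have route_w : route v2 w = p2.
  apply/funext => i; apply/funext => j; rewrite /route /= eqxx.
  by case: ifPn => // nij; case: pt2 => -[_ -> //].
have route_w' w' : w' != w -> route v2 w' = route v w'.
  by move=> /negbTE ww; rewrite /route /= ww.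
have [|rv2 dv2 nr2] := @carried_feasible _ _ v2
    (fun w' => if w' == w then t2 else node_rate v w').
  move=> w'; rewrite /carried; have [->|ww] := eqVneq w' w.
    by rewrite route_w.
  by rewrite route_w'//; exact: feasible_carried.
exists v2; split=> //; first by split=> //; case: fv.
move=> i j ij; rewrite /flow (bigD1 w)//= [in RHS](bigD1 w)//= nr2 eqxx mixE.
rewrite /route ij [in RHS]addrAC; congr (_ + _); first by ring.
by apply: eq_bigr => w' /negbTE ww; rewrite ww.
Qed.

Lemma optimal_session_routing v w p' t' :
  JOPR_solution v -> finite_cost v ->
  carries (@edge R net) (orig w) (dest w) (rate w) p' t' ->
  0 <= \sum_i \sum_j dDdF v i j * (t' i * p' i j - node_rate v w i * route v w i j).
Proof.
move=> sol fin pt'; have [fv _] := sol.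
have /choice[v_ v_P] e : exists v2, 0 <= e <= 1 ->
    [/\ feasible v2, forall i j, capacity v2 i j = capacity v i j
    & forall i j, edge i j -> flow v2 i j =
        flow v i j + e * (t' i * p' i j - node_rate v w i * phi v w i j)].
  have [e01|_] := boolP (0 <= e <= 1); last by exists v.
  by have [v2 ?] := mix_session_routing fv pt' e01; exists v2.
pose D i j := t' i * p' i j - node_rate v w i * phi v w i j.
have near01 : \forall e \near (0 : R)^'+, 0 <= e <= 1.
  near=> e; apply/andP; split; first by [].
  by apply: ltW; near: e; exact: nbhs_right_lt.
have Xc i j : edge i j ->
    \forall e \near (0 : R)^'+, Xdom (capacity v i j, flow v i j + e * D i j).
  move=> ij; apply: Xdom_curve; first exact: fin.
  (* If the total flow is 0, so is the share of session [w], and the direction [D i j] points into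
     the domain. *)
  move=> F0; rewrite /D subr_ge0; apply: (@le_trans _ _ 0).
    rewrite -F0 /flow (bigD1 w)//= lerDl sumr_ge0// => w' _.
    exact: flow_term_ge0.
  rewrite mulr_ge0 ?(carried_ge0 (rate_gt0 w) pt')//.
  by case: pt' => -[].
have H : 0 <= \sum_i \sum_(j | edge i j) dDdF v i j * D i j.
  apply: (optimal_variation (v_ := v_) sol fin).
  - by apply: filterS near01 => e /v_P[].
  - move=> i j ij; apply: filterS2 near01 (Xc i j ij) => e /v_P[_ cE fE].
    by rewrite cE fE.
  move=> i j ij; have [[C1 _ _] _ _ _ _] := hD ij; have [dF _ _] := C1.
  have := cvg_quot_in_curve (dF _ _ (fin i j ij)).2 (Xc i j ij).
  apply: cvg_trans; apply: near_eq_cvg.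
  by apply: filterS near01 => e /v_P[_ cE fE]; rewrite cE fE.
apply: le_trans H _; apply: ler_sum => i _; rewrite big_mkcond /=.
apply: ler_sum => j _; rewrite /D /route; case: ifPn => // nij.
by have [[_ pE _] _ _ _] := pt'; rewrite pE// !mulr0 subrr mulr0.
Unshelve. all: by end_near. Qed.

(** The row of the destination vanishes, so the boundary value is part of one linear system. *)
Lemma marginal_costP v (q : session net -> node net -> R) : routing_feasible v ->
  marginal_cost v q <->
  forall w i, q w i = \sum_j route v w i j * (dDdF v i j + q w j).
Proof.
move=> rv; have E w i : (if i == dest w then 0
      else \sum_(j | edge i j) phi v w i j * dphi v q w i j) =
    \sum_j route v w i j * (dDdF v i j + q w j).
  case: eqP => [->|_].
    rewrite big1// => j _; rewrite (routing_dest j ((routing_feasibleP v).1 rv w)).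
    by rewrite mul0r.
  rewrite big_mkcond; apply: eq_bigr => j _; rewrite /route.
  by case: ifP => //; rewrite mul0r.
by split=> qE w i; rewrite qE E.
Qed.

Lemma routing_necessity v : JOPR_solution v -> finite_cost v ->
  exists q, marginal_cost v q /\ forall w i, i != dest w -> 0 < node_rate v w i ->
    routing_condition_at v q w i.
Proof.
move=> sol fin; have [fv _] := sol; have [rv _ _] := fv.
have /choice[q qE] w : exists q, forall i,
    q i = \sum_j route v w i j * (dDdF v i j + q j).
  have vt := feasible_carried w fv; have [rw _ _ _] := vt.
  have [q qE] := trap_free_right_solvable
    (fun i => \sum_j route v w i j * dDdF v i j)
    (routing_substochastic rw) (carried_trap_free (rate_gt0 w) vt).
  exists q => i; rewrite qE -big_split; apply: eq_bigr => j _.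
  by rewrite mulrDr.
exists q; split; first exact/(marginal_costP _ rv).
move=> w i id ti; exists (q w i) => j ij.
have [conn _ _ _ _] := hnet.
have [qle qeq] := optimal_routing_condition (rate_gt0 w)
  (fun i j => @dDdF_gt0 v i j fin) (fun i => conn i (dest w))
  (feasible_carried w fv) (fun p' t' => optimal_session_routing sol fin)
  (qE w) id (lt0r_neq0 ti) ij.
split=> [pij|//]; apply: qeq.
by rewrite /route ij gt_eqF.
Qed.

Lemma flow_variation_ge0 v v' (q : session net -> node net -> R) :
  feasible v -> feasible v' -> marginal_cost v q ->
  (forall w i, i != dest w -> routing_condition_at v q w i) ->
  0 <= \sum_i \sum_(j | edge i j) dDdF v i j * (flow v' i j - flow v i j).
Proof.
move=> fv fv' qE cond; have [rv _ _] := fv.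
have -> : \sum_i \sum_(j | edge i j) dDdF v i j * (flow v' i j - flow v i j) =
    \sum_w \sum_i \sum_j dDdF v i j *
      (node_rate v' w i * route v' w i j - node_rate v w i * route v w i j).
  rewrite [RHS]exchange_big; apply: eq_bigr => i _.
  rewrite [RHS]exchange_big big_mkcond; apply: eq_bigr => j _.
  rewrite -mulr_sumr sumrB /route /flow; case: ifP => // _.
  by rewrite !big1 ?subrr ?mulr0// => w _; rewrite mulr0.
apply: sumr_ge0 => w _.
apply: (routing_condition_sufficient (rate_gt0 w) (feasible_carried w fv)
  (feasible_carried w fv') ((marginal_costP q rv).1 qE w)) => i id.
have [lam lamE] := cond w i id; exists lam => j ij.
by rewrite /route ij; exact: lamE.
Qed.

End RoutingOptimality.

(** * Power control *)

Section PowerControl.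
Context {R : realType} (net : network R).
Hypotheses (hnet : network_ok net) (hD : link_costs_ok net) (hC : capacity_ok net).
Implicit Types (v : vars net) (i j k l m n : node net).
Implicit Types (P Q z : node net -> node net -> R).

(* Coefficient of the power [P k l] in the interference at the link [(i, j)]. *)
Definition interference_coef i j k l : R :=
  if k == i then (if l == j then 0 else gain i j) else gain k j.

Definition interference P i j : R :=
  \sum_k \sum_(l | edge k l) interference_coef i j k l * P k l.

Definition powers_IN P i j : R := interference P i j + noise j.

Definition powers_SINR P i j : R := gain i j * P i j / powers_IN P i j.

Definition powers_capacity P i j : R :=
  if 0 < powers_SINR P i j then Cfun net (powers_SINR P i j) else 0.

Lemma interference_coef_ge0 i j k l : 0 <= interference_coef i j k l.
Proof.
by have [_ _ _ _ g0] := hnet; rewrite /interference_coef; case: ifP => // _; case: ifP.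
Qed.

(** Interference is all power received at [j] minus the signal itself. The first part treats all
    outgoing links of a sender alike. *)
Lemma interferenceE P i j : edge i j ->
  interference P i j = \sum_k \sum_(l | edge k l) gain k j * P k l - gain i j * P i j.
Proof.
move=> ij; rewrite /interference (bigD1 i)//= [in RHS](bigD1 i)//=.
rewrite (bigD1 j)//= [in RHS](bigD1 j)//= /interference_coef !eqxx mul0r add0r.
have -> (a b c : R) : a + b + c - a = b + c by ring.
congr (_ + _); first by apply: eq_bigr => l /andP[_ /negbTE ->].
by apply: eq_bigr => k /negbTE ki; apply: eq_bigr => l _; rewrite ki.
Qed.

Lemma eq_powers_capacity P Q i j : edge i j ->
  (forall k l, edge k l -> P k l = Q k l) -> powers_capacity P i j = powers_capacity Q i j.
Proof.
move=> ij PQ; suff E : powers_SINR P i j = powers_SINR Q i j.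
  by rewrite /powers_capacity E.
rewrite /powers_SINR /powers_IN /interference PQ//; congr (_ / (_ + _)).
by apply: eq_bigr => k _; apply: eq_bigr => l kl; rewrite PQ.
Qed.

Section Feasible.
Variable v : vars net.
Hypothesis fv : power_feasible v.

Lemma npower_gt0 i : 0 < npower v i.
Proof.
by have [_ _ Pb _ _] := hnet; rewrite /npower powR_gt0// (lt_trans _ (Pb i)).
Qed.

Lemma npower_le i : npower v i <= Pbar i.
Proof.
have [_ _ Pb _ _] := hnet; have [_ _ g1] := fv i.
rewrite /npower -[leRHS]powRr1 ?ler_powR ?(ltW (Pb i))//.
by rewrite ltW// (lt_trans _ (Pb i)).
Qed.

Lemma npower_max i : gam v i = 1 -> npower v i = Pbar i.
Proof.
have [_ _ Pb _ _] := hnet.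
by rewrite /npower => ->; rewrite powRr1// ltW// (lt_trans _ (Pb i)).
Qed.

Lemma npower_lt i : gam v i < 1 -> npower v i < Pbar i.
Proof.
have [_ _ Pb _ _] := hnet; move=> g1.
have Pb0 : 0 < Pbar i by rewrite (lt_trans _ (Pb i)).
rewrite -ltr_ln ?posrE ?npower_gt0// /npower ln_powR.
by rewrite gtr_pMl// ln_gt0.
Qed.

Lemma sum_lpower i : \sum_(j | edge i j) lpower v i j = npower v i.
Proof. by rewrite -mulr_sumr; have [_ -> _] := fv i; rewrite mulr1. Qed.

Lemma lpower_ge0 i j : edge i j -> 0 <= lpower v i j.
Proof.
by move=> ij; rewrite mulr_ge0 ?(ltW (npower_gt0 i))//; have [e0 _ _] := fv i; exact: e0.
Qed.

Lemma edge_exists i : exists j, edge i j.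
Proof.
apply: contrapT => /forallNP ne; have [_ + _] := fv i.
by rewrite big1 => [/eqP|j /ne//]; rewrite eq_sym oner_eq0.
Qed.

Lemma INE i j : edge i j -> IN v i j = powers_IN (lpower v) i j.
Proof.
move=> ij; rewrite /powers_IN interferenceE// /IN; congr (_ + _).
under [X in _ = X - _]eq_bigr do rewrite -mulr_sumr sum_lpower.
rewrite (bigD1 (P := xpredT) i)//= -sum_lpower [in X in _ = X - _](bigD1 j)//=.
by ring.
Qed.

Lemma powers_IN_gt0 i j : 0 < powers_IN (lpower v) i j.
Proof.
have [_ _ _ n0 _] := hnet; rewrite ltr_wpDl// sumr_ge0// => k _.
by rewrite sumr_ge0// => l kl; rewrite mulr_ge0 ?interference_coef_ge0 ?lpower_ge0.
Qed.

Lemma IN_gt0 i j : edge i j -> 0 < IN v i j.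
Proof. by move=> /INE ->; exact: powers_IN_gt0. Qed.

Lemma SINRE i j : edge i j -> SINR v i j = powers_SINR (lpower v) i j.
Proof. by move=> ij; rewrite /SINR INE. Qed.

Lemma capacityE i j : edge i j -> capacity v i j = powers_capacity (lpower v) i j.
Proof. by move=> ij; rewrite /capacity SINRE. Qed.

Hypothesis fin : finite_cost v.

Lemma SINR_gt0 i j : edge i j -> 0 < SINR v i j.
Proof.
move=> ij; have := fin ij; rewrite /Xdom /= => /andP[F0].
by move=> /(le_lt_trans F0); rewrite /capacity; case: ifP => //; rewrite ltxx.
Qed.

Lemma gain_gt0 i j : edge i j -> 0 < gain i j.
Proof.
have [_ _ _ _ g0] := hnet; move=> /SINR_gt0/lt0r_neq0 xn0; rewrite lt_def g0 andbT.
by apply: contra_neq xn0; rewrite /SINR => ->; rewrite !mul0r.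
Qed.

Lemma lpower_gt0 i j : edge i j -> 0 < lpower v i j.
Proof.
move=> ij; have /lt0r_neq0 xn0 := SINR_gt0 ij; rewrite lt_def lpower_ge0// andbT.
by apply: contra_neq xn0; rewrite /SINR => ->; rewrite mulr0 mul0r.
Qed.

Lemma eta_gt0 i j : edge i j -> 0 < eta v i j.
Proof. by move=> /lpower_gt0; rewrite /lpower pmulr_rgt0 ?npower_gt0. Qed.

Lemma capacity_Cfun i j : edge i j -> capacity v i j = Cfun net (SINR v i j).
Proof. by move=> /SINR_gt0 x0; rewrite /capacity x0. Qed.

(* Derivative of the cost of the link [(i, j)] with respect to [ln (SINR i j)]. *)
Definition dDdlogx i j : R :=
  dDdC v i j * (derive1 (Cfun net) (SINR v i j) * SINR v i j).

(* Marginal interference cost of node [i], per unit of its power. *)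
Definition marginal_interference i : R :=
  - (\sum_m \sum_(n | edge m n)
        dDdC v m n * (derive1 (Cfun net) (SINR v m n) * gain m n * gain i n *
                      lpower v m n / IN v m n ^+ 2)).

Lemma dgamE i : dgam v i / npower v i =
  marginal_interference i + \sum_(j | edge i j) deta v i j * eta v i j.
Proof. by rewrite /dgam mulrC mulKf// gt_eqF// npower_gt0. Qed.

(** [dgam] is the derivative of the cost when all powers of node [i] are scaled together. *)
Lemma sum_dgam i : \sum_(l | edge i l) lpower v i l * (deta v i l + marginal_interference i) =
  dgam v i.
Proof.
under eq_bigr do rewrite mulrDr.
rewrite big_split /= -mulr_suml sum_lpower /dgam mulrDr [RHS]addrC; congr (_ + _).
by rewrite mulr_sumr; apply: eq_bigr => l _; rewrite /lpower; ring.
Qed.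

(** Chain rule in logarithmic powers, with [z] the variation of [ln P]. [marginal_interference k]
    charges a link for its own signal as well; the summand [SINR] of the factor [1 + SINR] in [deta]
    refunds this charge, and the summand 1 is the direct effect of the power. *)
Lemma power_gradient z :
  \sum_m \sum_(n | edge m n) dDdlogx m n *
    (z m n - interference (fun k l => lpower v k l * z k l) m n / IN v m n) =
  \sum_k \sum_(l | edge k l)
    lpower v k l * z k l * (deta v k l + marginal_interference k).
Proof.
have E1 m n : edge m n -> dDdlogx m n *
    (z m n - interference (fun k l => lpower v k l * z k l) m n / IN v m n) =
    lpower v m n * z m n * deta v m n -
    \sum_k \sum_(l | edge k l) lpower v k l * z k l *
      (dDdC v m n * (derive1 (Cfun net) (SINR v m n) * gain m n * gain k n *
                      lpower v m n / IN v m n ^+ 2)).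
  move=> mn; rewrite interferenceE//.
  have -> : \sum_k \sum_(l | edge k l) lpower v k l * z k l *
      (dDdC v m n * (derive1 (Cfun net) (SINR v m n) * gain m n * gain k n *
                      lpower v m n / IN v m n ^+ 2)) =
      dDdC v m n * (derive1 (Cfun net) (SINR v m n) * gain m n *
                      lpower v m n / IN v m n ^+ 2) *
      (\sum_k \sum_(l | edge k l) gain k n * (lpower v k l * z k l)).
    rewrite mulr_sumr; apply: eq_bigr => k _.
    by rewrite mulr_sumr; apply: eq_bigr => l _; ring.
  rewrite /dDdlogx /deta; set S := \sum_k _; set C' := derive1 _ _.
  by rewrite /SINR; field; rewrite gt_eqF// IN_gt0.
under eq_bigr do under eq_bigr => n mn do rewrite E1//.
under eq_bigr do rewrite sumrB.
rewrite sumrB.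
under [RHS]eq_bigr do under eq_bigr do rewrite mulrDr.
under [RHS]eq_bigr do rewrite big_split /=.
rewrite big_split /=; congr (_ + _).
rewrite /marginal_interference.
under [RHS]eq_bigr do rewrite -mulr_suml mulrN.
rewrite sumrN; congr (- _).
under eq_bigr do rewrite exchange_big /=.
rewrite exchange_big /=; apply: eq_bigr => k _.
rewrite mulr_sumr; apply: eq_bigr => m _.
by rewrite mulr_sumr; apply: eq_bigr => n mn; rewrite mulr_suml.
Qed.

End Feasible.

(** Inverse of the passage from [eta], [gam] to link powers; the division by [ln (Pbar i)] is
    legitimate since [Pbar i > 1]. *)
Definition set_power v P : vars net :=
  Vars (phi v) (fun i j => P i j / \sum_(l | edge i l) P i l)
    (fun i => ln (\sum_(l | edge i l) P i l) / ln (Pbar i)).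

Section SetPower.
Variables (v : vars net) (P : node net -> node net -> R).
Hypothesis P_gt0 : forall i j, edge i j -> 0 < P i j.
Hypothesis P_edge : forall i, exists j, edge i j.
Hypothesis P_le : forall i, \sum_(l | edge i l) P i l <= Pbar i.

Let sumP_gt0 i : 0 < \sum_(l | edge i l) P i l.
Proof.
have [j ij] := P_edge i; rewrite (bigD1 j)//= ltr_pwDl ?P_gt0//.
by apply: sumr_ge0 => l /andP[il _]; rewrite ltW// P_gt0.
Qed.

Let lnPbar_gt0 i : 0 < ln (Pbar i).
Proof. by have [_ _ Pb _ _] := hnet; rewrite ln_gt0. Qed.

Lemma set_power_feasible : power_feasible (set_power v P).
Proof.
have [_ _ Pb _ _] := hnet.
move=> i; split=> [j ij||] /=.
- by rewrite divr_ge0 ?(ltW (sumP_gt0 i))// ltW// P_gt0.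
- by rewrite -mulr_suml mulfV// gt_eqF.
rewrite ler_pdivrMr// mul1r ler_ln ?posrE//.
by rewrite (lt_trans _ (Pb i)).
Qed.

Lemma lpower_set_power i j : lpower (set_power v P) i j = P i j.
Proof.
have [_ _ Pb _ _] := hnet.
have -> : lpower (set_power v P) i j =
    npower (set_power v P) i * (P i j / \sum_(l | edge i l) P i l) by [].
suff -> : npower (set_power v P) i = \sum_(l | edge i l) P i l.
  by rewrite mulrC divfK// gt_eqF.
have Pb0 : 0 < Pbar i by rewrite (lt_trans _ (Pb i)).
by rewrite /npower /powR gt_eqF//= divfK ?lnK ?posrE// gt_eqF.
Qed.

Lemma capacity_set_power i j : edge i j ->
  capacity (set_power v P) i j = powers_capacity P i j.
Proof.
move=> ij; rewrite (capacityE set_power_feasible ij).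
by apply: eq_powers_capacity => // k l _; exact: lpower_set_power.
Qed.

End SetPower.

Lemma is_derive_affine (a b : R) : is_derive (0 : R) 1 (fun e : R => a + e * b) b.
Proof.
have := is_deriveD (is_derive_cst a (0 : R) 1)
  (is_deriveM (is_derive_id (0 : R) 1) (is_derive_cst b (0 : R) 1)).
by rewrite /GRing.scale /= mul0r mulr1 !add0r.
Qed.

Lemma is_derive_powers_SINR P Q i j : powers_IN P i j != 0 ->
  is_derive (0 : R) 1 (fun e : R => powers_SINR (fun k l => P k l + e * Q k l) i j)
    (gain i j * (Q i j * powers_IN P i j - P i j * interference Q i j) /
     powers_IN P i j ^+ 2).
Proof.
move=> IN0.
have INe (e : R) : powers_IN (fun k l => P k l + e * Q k l) i j =
    powers_IN P i j + e * interference Q i j.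
  rewrite /powers_IN [RHS]addrAC; congr (_ + _).
  rewrite /interference mulr_sumr -big_split; apply: eq_bigr => k _.
  rewrite mulr_sumr -big_split; apply: eq_bigr => l _ /=; ring.
rewrite (_ : (fun e => _) = (fun e : R => gain i j * P i j + e * (gain i j * Q i j)) *
    (fun e : R => (powers_IN P i j + e * interference Q i j)^-1)); last first.
  by apply/funext => e; rewrite /powers_SINR INe /=; congr (_ / _); ring.
have dden := is_derive_affine (powers_IN P i j) (interference Q i j).
have [|] := is_deriveM (is_derive_affine (gain i j * P i j) (gain i j * Q i j))
  (is_deriveV _ dden).
  by rewrite mul0r addr0.
move=> d dE; split => //; rewrite dE /GRing.scale /= !mul0r !addr0.
by field.
Qed.

Lemma power_variation v (y : node net -> node net -> R) :
  JOPR_solution v -> finite_cost v ->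
  (forall k, gam v k = 1 -> \sum_(l | edge k l) y k l <= 0) ->
  0 <= \sum_k \sum_(l | edge k l) y k l * (deta v k l + marginal_interference v k).
Proof.
move=> sol fin y_le; have [[rv dv fv] _] := sol.
pose Q k l := if edge k l then y k l else 0.
pose P (e : R) k l := lpower v k l + e * Q k l.
(* Rate of change of the logarithm of the power, the form in which [power_gradient] is stated. *)
pose z k l := Q k l / lpower v k l.
have Pz k l : edge k l -> lpower v k l * z k l = y k l.
  by move=> kl; rewrite /z /Q kl mulrC divfK// gt_eqF// lpower_gt0.
have lim0 (a b : R) : a + e * b @[e --> (0 : R)^'+] --> a.
  apply: cvg_at_right_filter; rewrite -[X in _ --> X]addr0.
  apply: cvgD; first exact: cvg_cst.
  rewrite -[X in _ --> X](mul0r b).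
  by apply: cvgM; [exact: cvg_id|exact: cvg_cst].
have P_gt0 : \forall e \near (0 : R)^'+, forall i j, edge i j -> 0 < P e i j.
  apply: filter_forall => i; apply: filter_forall => j.
  have [ij|nij] := boolP (edge i j); last by apply: nearW => e.
  have : \forall e \near (0 : R)^'+, 0 < P e i j.
    by apply: (cvgr_gt _ (lim0 _ _)); exact: lpower_gt0.
  by apply: filterS.
have sumPE e k : \sum_(l | edge k l) P e k l =
    npower v k + e * \sum_(l | edge k l) y k l.
  rewrite big_split /= sum_lpower// mulr_sumr; congr (_ + _).
  by apply: eq_bigr => l kl; rewrite /Q kl.
have P_le : \forall e \near (0 : R)^'+, forall k, \sum_(l | edge k l) P e k l <= Pbar k.
  apply: filter_forall => k; under eq_near do rewrite sumPE.
  have [_ _] := fv k; rewrite le_eqVlt => /predU1P[g1|g1].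
    near=> e; rewrite npower_max// gerDl mulr_ge0_le0//; exact: y_le.
  have : \forall e \near (0 : R)^'+, npower v k + e * (\sum_(l | edge k l) y k l) < Pbar k.
    by apply: (cvgr_lt _ (lim0 _ _)); exact: npower_lt.
  by apply: filterS => e /ltW.
have capE : \forall e \near (0 : R)^'+, forall i j, edge i j ->
    capacity (set_power v (P e)) i j = powers_capacity (P e) i j.
  apply: filterS2 P_gt0 P_le => e Pe0 Ple i j ij.
  by apply: capacity_set_power => //; exact: edge_exists.
have flowE e i j : flow (set_power v (P e)) i j = flow v i j by [].
pose x i j (e : R) := powers_SINR (P e) i j.
have x0 i j : edge i j -> x i j 0 = SINR v i j.
  move=> ij; rewrite SINRE// /x; congr (_ / (_ + _)).
    by rewrite /P mul0r addr0.
  by apply: eq_bigr => k _; apply: eq_bigr => l _; rewrite /P mul0r addr0.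
have IN0 i j : edge i j -> powers_IN (lpower v) i j != 0.
  by move=> ij; rewrite gt_eqF// powers_IN_gt0.
have dx i j : edge i j -> is_derive (0 : R) 1 (x i j)
    (SINR v i j * (z i j - interference (fun k l => lpower v k l * z k l) i j / IN v i j)).
  move=> ij; apply: is_derive_eq.
    exact: is_derive_powers_SINR (IN0 i j ij).
  have -> : interference (fun k l => lpower v k l * z k l) i j = interference Q i j.
    apply: eq_bigr => k _; apply: eq_bigr => l kl.
    by rewrite Pz// /Q kl.
  rewrite /SINR INE// /z; field.
  by rewrite IN0//= gt_eqF// lpower_gt0.
have dc i j : edge i j -> is_derive (0 : R) 1 (Cfun net \o x i j)
    (derive1 (Cfun net) (SINR v i j) * (SINR v i j *
      (z i j - interference (fun k l => lpower v k l * z k l) i j / IN v i j))).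
  move=> ij; have dxx := dx i j ij.
  have dC : is_derive (x i j 0) 1 (Cfun net) (derive1 (Cfun net) (SINR v i j)).
    rewrite x0//; have [_ _ /(_ _ (SINR_gt0 fin ij))[dC _] _ _] := hC.
    by split=> //; rewrite derive1E.
  exact: is_derive1_comp.
have cE i j : edge i j -> \forall e \near (0 : R)^'+,
    capacity (set_power v (P e)) i j = Cfun net (x i j e).
  move=> ij; have xp : \forall e \near (0 : R)^'+, 0 < x i j e.
    have cx : {for 0, continuous (x i j)}.
      by apply: differentiable_continuous; apply/derivable1_diffP; case: (dx i j ij).
    by apply: (cvgr_gt _ (cvg_at_right_filter cx)); rewrite x0// SINR_gt0.
  apply: filterS2 capE xp => e -> // xe0.
  by rewrite /powers_capacity -/(x i j e) xe0.
have c0 i j : edge i j -> (Cfun net \o x i j) 0 = capacity v i j.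
  by move=> ij; rewrite /= x0// capacity_Cfun.
have Xc i j : edge i j -> \forall e \near (0 : R)^'+,
    Xdom (capacity (set_power v (P e)) i j, flow (set_power v (P e)) i j).
  move=> ij; have cc : {for 0, continuous (Cfun net \o x i j)}.
    by apply: differentiable_continuous; apply/derivable1_diffP; case: (dc i j ij).
  have : \forall e \near (0 : R)^'+, flow v i j < (Cfun net \o x i j) e.
    apply: (cvgr_gt _ (cvg_at_right_filter cc)); rewrite c0//.
    by have /andP[] := fin i j ij.
  apply: filterS2 (cE i j ij) => e -> cl.
  by rewrite /Xdom /= flowE cl andbT; have /andP[] := fin i j ij.
have : 0 <= \sum_m \sum_(n | edge m n) dDdlogx v m n *
    (z m n - interference (fun k l => lpower v k l * z k l) m n / IN v m n).
  apply: (optimal_variation (v_ := fun e => set_power v (P e)) sol fin) => //.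
    apply: filterS2 P_gt0 P_le => e Pe0 Ple; split=> //.
    by apply: set_power_feasible => //; exact: edge_exists.
  move=> i j ij; have [[C1 _ _] _ _ _ _] := hD ij; have [dD _ _] := C1.
  have XF : nbhs (capacity v i j) [set c' | Xdom (c', flow v i j)].
    have /andP[/= F0 Fc] := fin i j ij; rewrite /Xdom /= F0 /=.
    exact: lt_nbhsr.
  have dDc : is_derive ((Cfun net \o x i j) 0) 1
      (fun c => Dcost i j c (flow v i j)) (dDdC v i j).
    rewrite c0//; apply: is_derive_in => //; exact: (dD _ _ (fin i j ij)).1.
  have dcc := dc i j ij.
  have := is_derive_quot_right (is_derive1_comp dDc dcc).
  rewrite /dDdlogx !mulrA; apply: cvg_trans; apply: near_eq_cvg.
  apply: filterS (cE i j ij) => e ce.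
  by rewrite flowE ce /= -[in RHS]c0.
rewrite power_gradient//; congr (_ <= _).
by apply: eq_bigr => k _; apply: eq_bigr => l kl; rewrite Pz.
Unshelve. all: by end_near. Qed.

End PowerControl.

(** * First-order conditions for the powers *)

Section PowerOptimality.
Context {R : realType} (net : network R).
Hypotheses (hnet : network_ok net) (hD : link_costs_ok net) (hC : capacity_ok net).
Implicit Types (v : vars net) (i j k l m n : node net).

Lemma sum_node (i : node net) (f : node net -> node net -> R) :
  \sum_k \sum_(l | edge k l) (k == i)%:R * f k l = \sum_(l | edge i l) f i l.
Proof.
rewrite (bigD1 i)//= [X in _ + X]big1 ?addr0.
  by apply: eq_bigr => l _; rewrite eqxx mul1r.
by move=> k /negbTE ki; rewrite big1// => l _; rewrite ki mul0r.
Qed.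

Lemma sum_edge (i j : node net) (f : node net -> R) : edge i j ->
  \sum_(l | edge i l) (l == j)%:R * f l = f j.
Proof.
move=> ij; rewrite (bigD1 j)//= eqxx mul1r big1 ?addr0// => l /andP[_ /negbTE ->].
by rewrite mul0r.
Qed.

Lemma power_necessity v : JOPR_solution v -> finite_cost v -> power_condition v.
Proof.
move=> sol fin i; have [[_ _ fv] _] := sol; split; first exact: eta_gt0.
have npos := npower_gt0 hnet v.
have deta_le j j' : edge i j -> edge i j' -> deta v i j' <= deta v i j.
  move=> ij ij'.
  (* Moving power from [j'] to [j] keeps the total of node [i]: it is allowed even at full power,
     and the marginal interference cancels. *)
  pose y k l : R := (k == i)%:R * ((l == j)%:R - (l == j')%:R).
  have := power_variation hnet hD hC (y := y) sol fin.
  rewrite /y; under eq_bigr do under eq_bigr do rewrite -mulrA.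
  rewrite sum_node; under eq_bigr do rewrite mulrBl.
  rewrite sumrB !sum_edge// opprD addrACA subrr addr0 subr_ge0; apply=> k _.
  rewrite -mulr_sumr; have [->|_] := eqVneq k i; last by rewrite mul0r.
  rewrite mul1r sumrB.
  have := @sum_edge i j (fun=> 1) ij; under eq_bigr do rewrite mulr1; move=> ->.
  have := @sum_edge i j' (fun=> 1) ij'; under eq_bigr do rewrite mulr1; move=> ->.
  by rewrite subrr.
have dgam_dir (s : R) : (gam v i = 1 -> s <= 0) -> 0 <= s * dgam v i.
  move=> s1.
  (* Scaling the powers of node [i]: both signs of [s] are allowed below the budget, only [s <= 0]
     on it. *)
  pose y k l : R := (k == i)%:R * (s * lpower v k l).
  have := power_variation hnet hD hC (y := y) sol fin.
  rewrite /y; under eq_bigr do under eq_bigr do rewrite -mulrA.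
  rewrite sum_node; under eq_bigr do rewrite -mulrA.
  rewrite -mulr_sumr sum_dgam//; apply=> k gk.
  rewrite -mulr_sumr; have [ki|_] := eqVneq k i; last by rewrite mul0r.
  rewrite mul1r -mulr_sumr sum_lpower//; apply: mulr_le0_ge0; last exact/ltW/npos.
  by apply: s1; rewrite -ki.
have [j0 ij0] := edge_exists fv i.
exists (deta v i j0); split.
- by move=> j ij; apply/le_anti; rewrite !deta_le.
- move=> g1; suff -> : dgam v i = 0 by rewrite mul0r.
  have gn1 s : gam v i = 1 -> s <= 0 :> R by move=> ge1; rewrite ge1 ltxx in g1.
  have := dgam_dir 1 (gn1 _); have := dgam_dir (-1) (gn1 _); lra.
- move=> g1; apply: mulr_le0_ge0; last by rewrite invr_ge0 ltW.
  by have := dgam_dir (-1) (fun=> lerN10 _); lra.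
Qed.

Lemma ln_le_sub1 (x : R) : 0 < x -> ln x <= x - 1.
Proof.
by move=> x0; have := @le_ln1Dx R (x - 1); rewrite subrKC; apply; rewrite ltrBrDr addNr.
Qed.

(* Log-sum-exp convexity: [ln (powers_IN P)] is convex in the variables [ln P]. *)
Lemma interference_log_tangent (P Q : node net -> node net -> R) i j :
  (forall k l, edge k l -> 0 < P k l /\ 0 < Q k l) ->
  interference (fun k l => P k l * (ln (Q k l) - ln (P k l))) i j / powers_IN P i j <=
  ln (powers_IN Q i j) - ln (powers_IN P i j).
Proof.
move=> PQ; have [_ _ _ n0 _] := hnet; have c0 := n0 j.
pose a := interference_coef i j; have a0 k l : 0 <= a k l by exact: interference_coef_ge0.
have IN0 r : (forall k l, edge k l -> 0 < r k l) -> 0 < powers_IN r i j.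
  move=> r0; rewrite ltr_wpDl// sumr_ge0// => k _; apply: sumr_ge0 => l kl.
  by rewrite mulr_ge0// ltW// r0.
have Sp : 0 < powers_IN P i j by apply: IN0 => k l /PQ[].
have Sq : 0 < powers_IN Q i j by apply: IN0 => k l /PQ[].
pose L := ln (powers_IN Q i j) - ln (powers_IN P i j).
pose r := powers_IN Q i j / powers_IN P i j.
have r0 : 0 < r by rewrite divr_gt0.
have Lr : L = ln r by rewrite /r ln_div ?posrE.
rewrite ler_pdivrMr// -/L.
(* Termwise [ln u <= u - 1] with [u] the power ratio divided by [r]; this normalization makes the
   errors cancel in the sum. *)
apply: (@le_trans _ _ (\sum_k \sum_(l | edge k l)
    ((L - 1) * (a k l * P k l) + a k l * Q k l / r))).
  apply: ler_sum => k _; apply: ler_sum => l kl; have [p0 q0] := PQ k l kl.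
  have := @ln_le_sub1 (Q k l / P k l / r).
  rewrite !divr_gt0// (@ln_div _ _ r) ?posrE ?divr_gt0// -Lr ln_div ?posrE// => /(_ isT) H.
  have -> : (L - 1) * (a k l * P k l) + a k l * Q k l / r =
      a k l * (P k l * (L + (Q k l / P k l / r - 1))).
    by field; rewrite !gt_eqF.
  by rewrite ler_wpM2l// ler_wpM2l ?(ltW p0)//; lra.
under eq_bigr do rewrite big_split /= -mulr_sumr -mulr_suml.
rewrite big_split /= -mulr_sumr -mulr_suml -/(interference P i j) -/(interference Q i j).
have H := @ln_le_sub1 r^-1; rewrite lnV ?posrE// invr_gt0 in H.
(* The noise is one more term of the sum, whose own logarithmic ratio is 0. *)
have : noise j * (1 - L - r^-1) <= 0.
  by rewrite mulr_ge0_le0 ?(ltW c0)//; have := H r0; rewrite Lr; lra.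
have -> : interference Q i j / r = powers_IN P i j - noise j / r.
  have -> : interference Q i j = powers_IN Q i j - noise j by rewrite /powers_IN addrK.
  by rewrite /r; field; rewrite !gt_eqF.
by rewrite /powers_IN; lra.
Qed.

Definition log_power_ratio v v' k l : R := ln (lpower v' k l) - ln (lpower v k l).

(** Both tangent inequalities bound the new capacity from above; the negative [dDdC] turns them into
    a lower bound for the cost. *)
Lemma capacity_variation v v' i j : power_feasible v -> power_feasible v' ->
  finite_cost v -> finite_cost v' -> edge i j ->
  dDdlogx v i j * (log_power_ratio v v' i j -
    interference (fun k l => lpower v k l * log_power_ratio v v' k l) i j / IN v i j) <=
  dDdC v i j * (capacity v' i j - capacity v i j).
Proof.
move=> fv fv' fin fin' ij.
have [C_incr _ C_der _ C_log] := hC.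
have x0 := SINR_gt0 fin ij; have x0' := SINR_gt0 fin' ij.
rewrite !capacity_Cfun// /dDdlogx -mulrA ler_nM2l ?dDdC_lt0//.
apply: (le_trans (capacity_log_tangent C_der C_log x0 x0')).
rewrite ler_wpM2l//.
  by rewrite mulr_ge0 ?(ltW x0)// (capacity_derive1_ge0 C_incr C_der).
have g0 := gain_gt0 hnet fin ij.
have p0 := lpower_gt0 hnet fv fin ij; have p0' := lpower_gt0 hnet fv' fin' ij.
have IN0 := IN_gt0 hnet fv ij; have IN0' := IN_gt0 hnet fv' ij.
have lnx (a b c : R) : 0 < a -> 0 < b -> 0 < c -> ln (a * b / c) = ln a + ln b - ln c.
  by move=> a1 b1 c1; rewrite ln_div ?lnM ?posrE ?mulr_gt0.
rewrite /SINR !lnx// !INE//.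
have PQ k l : edge k l -> 0 < lpower v k l /\ 0 < lpower v' k l.
  by move=> kl; split; exact: lpower_gt0.
by have := interference_log_tangent i j PQ; rewrite /log_power_ratio; set B := _ / _; lra.
Qed.

Lemma power_variation_ge0 v v' : power_feasible v -> power_feasible v' ->
  finite_cost v -> finite_cost v' -> power_condition v ->
  0 <= \sum_i \sum_(j | edge i j) dDdC v i j * (capacity v' i j - capacity v i j).
Proof.
move=> fv fv' fin fin' cond.
pose z := log_power_ratio v v'.
apply: (@le_trans _ _ (\sum_i \sum_(j | edge i j) dDdlogx v i j *
    (z i j - interference (fun k l => lpower v k l * z k l) i j / IN v i j))); last first.
  by apply: ler_sum => i _; apply: ler_sum => j ij; exact: capacity_variation.
rewrite power_gradient//; apply: sumr_ge0 => k _.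
have [_ [nu [detaE mu0 mu_le]]] := cond k.
(* The derivative of the cost with respect to the power is the same on all outgoing links of [k],
   because the [eta] sum to 1. *)
have muE : dgam v k / npower v k = marginal_interference v k + nu.
  rewrite dgamE//; congr (_ + _); have [_ eta1 _] := fv k.
  rewrite -[RHS]mulr1 -eta1 mulr_sumr; apply: eq_bigr => l kl.
  by rewrite detaE.
under eq_bigr => l kl do rewrite detaE// addrC -muE.
rewrite -mulr_suml; have [_ _] := fv k; rewrite le_eqVlt => /predU1P[g1|g1].
  apply: mulr_le0; last exact: mu_le.
  (* By [P * ln (P' / P) <= P' - P] the logarithmic change is at most the change of total power,
     which is nonpositive when [v] already spends [Pbar k]. *)
  apply: (@le_trans _ _ (\sum_(l | edge k l) (lpower v' k l - lpower v k l))).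
    apply: ler_sum => l kl.
    have p0 := lpower_gt0 hnet fv fin kl; have p0' := lpower_gt0 hnet fv' fin' kl.
    rewrite /z /log_power_ratio -ln_div ?posrE//.
    have H := ln_le_sub1 (divr_gt0 p0' p0).
    apply: (le_trans (ler_wpM2l (ltW p0) H)).
    by rewrite mulrBr mulr1 mulrC divfK// gt_eqF.
  by rewrite sumrB !sum_lpower// subr_le0 (npower_max hnet g1) npower_le.
by rewrite mu0// mulr0.
Qed.

Lemma sufficiency v (q : session net -> node net -> R) : link_costs_convex net ->
  feasible v -> finite_cost v -> marginal_cost v q ->
  (forall w i, i != dest w -> routing_condition_at v q w i) ->
  power_condition v -> JOPR_solution v.
Proof.
move=> conv fv fin qE rcond pcond; split=> // v' fv'.
have [/total_cost_ltyP fin'|] := boolP (total_cost v' < +oo)%E; last first.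
  by rewrite -leNgt leye_eq => /eqP ->; exact: leey.
rewrite !total_cost_finite// lee_fin -subr_ge0 /real_cost -sumrB.
have [_ _ pv] := fv; have [_ _ pv'] := fv'.
have rge := flow_variation_ge0 hnet fv fv' qE rcond.
have pge := power_variation_ge0 pv pv' fin fin' pcond.
apply: le_trans (addr_ge0 pge rge) _.
rewrite -big_split; apply: ler_sum => i _; rewrite -big_split -sumrB.
apply: ler_sum => j ij; have [[C1 _ _] _ _ _ _] := hD ij.
exact: (convex_tangent C1 (conv i j ij) (fin i j ij) (fin' i j ij)).
Qed.

End PowerOptimality.

Theorem theorem1 (R : realType) (net : network R)
    (hnet : network_ok net) (hD : link_costs_ok net) (hC : capacity_ok net) :
  (forall v : vars net,
     JOPR_solution v -> (total_cost v < +oo)%E ->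
     (exists q : session net -> node net -> R,
        marginal_cost v q /\
        forall (w : session net) (i : node net),
          i != dest w -> 0 < node_rate v w i ->
          routing_condition_at v q w i) /\
     power_condition v) /\
  (link_costs_convex net ->
   forall v : vars net,
     feasible v -> (total_cost v < +oo)%E ->
     (exists q : session net -> node net -> R,
        marginal_cost v q /\
        forall (w : session net) (i : node net),
          i != dest w -> routing_condition_at v q w i) ->
     power_condition v ->
     JOPR_solution v).
Proof.
split=> [v sol /total_cost_ltyP fin|conv v fv /total_cost_ltyP fin [q [qE rcond]] pcond].
  split; first exact: routing_necessity.
  exact: power_necessity.
exact: (sufficiency hnet hD hC conv fv fin qE rcond pcond).
Qed.
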